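(* Let $\sigma_0$ be the probability measure on $\mathbb{R}$ with density $w(x)=1$ for $x\in[-1,-\frac12]\cup[\frac12,1]$ and $w(x)=0$ otherwise. Then there exist $C,c>0$ such that $$d_n(\sigma_0)\ge c\sqrt n\quad\text{for even }n,\qquad d_n(\sigma_0)\le C\ln(Cn)\quad\text{for odd }n.$$ In particular, there exist $C_1,c_1>0$ such that for every $k\in\mathbb{N}$, $$n^0_{\sigma_0}(k)\le C_1k^2\qquad\text{and}\qquad n_{\sigma_0}(k)\ge c_1e^{c_1k}.$$
   Context: $\mathbb{N}=\{1,2,\dots\}$. For a probability measure $\sigma$ on $\mathbb{R}$ with all moments finite, a Chebyshev-type quadrature of degree at least $k$ with $n$ nodes consists of points $x_1,\dots,x_n\in\mathbb{R}$, not necessarily distinct, with $\int x^j d\sigma(x)=\frac1n\sum_{i=1}^n x_i^j$ for all $0\le j\le k$. For $n\in\mathbb{N}$, $d_n(\sigma)$ is the maximal possible degree $k$ of a Chebyshev-type quadrature for $\sigma$ having exactly $n$ (not necessarily distinct) nodes ($\infty$ if any degree can be attained). $n^0_\sigma(k)$ is the minimal $n$ such that a Chebyshev-type quadrature for $\sigma$ of degree at least $k$ with $n$ nodes exists ($\infty$ if none). $n_\sigma(k)$ is the minimal integer such that for every $n\ge n_\sigma(k)$ there exists a Chebyshev-type quadrature for $\sigma$ of degree at least $k$ having exactly $n$ nodes ($\infty$ if no such integer exists). *)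

(* Defs.v *)
From HB Require Import structures.
From mathcomp Require Import all_boot all_order all_algebra.
From mathcomp Require Import all_classical all_reals all_analysis.
From mathcomp Require Import measurable_realfun.
Set Implicit Arguments.
Unset Strict Implicit.
Unset Printing Implicit Defensive.
Import Order.TTheory GRing.Theory Num.Theory.
Import numFieldNormedType.Exports.
Local Open Scope classical_set_scope.
Local Open Scope ring_scope.

Section chebyshev_quadrature.
Context {R : realType}.
Implicit Types sigma : probability (measurableTypeR R) R.

(* The equation is stated in [\bar R], so it can only hold for the degrees [j]
   at which the moment of [sigma] is finite. *)
Definition chebyshev_quadrature sigma (k n : nat) (x : 'I_n -> R) : Prop :=
  forall j : nat, (j <= k)%N ->
    (\int[sigma]_t (t ^+ j)%:E)%E = (n%:R^-1 * \sum_(i < n) x i ^+ j)%:E.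

Definition has_chebyshev_quadrature sigma (k n : nat) : Prop :=
  exists x : 'I_n -> R, chebyshev_quadrature sigma k x.

(* Extremal values live in [\bar R]: the supremum of a nonempty set of naturals
   is its maximum, or +oo if it is unbounded, and the infimum of a set of
   naturals is its minimum, or +oo if it is empty. For n > 0 the degree 0 is
   always attained. *)
Definition max_degree sigma (n : nat) : \bar R :=
  ereal_sup [set k%:R%:E | k in [set k : nat |
    has_chebyshev_quadrature sigma k n]].

Definition min_nodes sigma (k : nat) : \bar R :=
  ereal_inf [set n%:R%:E | n in [set n : nat |
    (0 < n)%N /\ has_chebyshev_quadrature sigma k n]].

Definition min_nodes_onward sigma (k : nat) : \bar R :=
  ereal_inf [set N%:R%:E | N in [set N : nat | (0 < N)%N /\
    forall n : nat, (N <= n)%N -> has_chebyshev_quadrature sigma k n]].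

End chebyshev_quadrature.

Section two_intervals.
Context {R : realType}.
Local Notation mu := (@lebesgue_measure R).

Definition two_itv : set R := `[-1, - 2^-1] `|` `[2^-1, 1].

Definition density_two_itv (x : R) : R := if x \in two_itv then 1 else 0.

Lemma density_indic : density_two_itv = \1_two_itv.
Proof. by apply/funext => x; rewrite /density_two_itv indicE; case: ifP. Qed.

Lemma density_ge0 x : 0 <= density_two_itv x.
Proof. by rewrite density_indic. Qed.

Lemma measurable_two_itv : measurable two_itv.
Proof. exact: measurableU. Qed.

Lemma measurable_density : measurable_fun setT density_two_itv.
Proof. by rewrite density_indic; apply: measurable_indic; exact: measurable_two_itv. Qed.

Lemma lebesgue_two_itv : mu two_itv = 1%E.
Proof.
have m1 : mu `[-1, - 2^-1] = (1 - 2^-1)%:E.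
  by rewrite lebesgue_measure_itv/= lte_fin ltrN2 invf_lt1// ltr1n -EFinB opprK addrC.
have m2 : mu `[2^-1, 1] = (1 - 2^-1)%:E.
  by rewrite lebesgue_measure_itv/= lte_fin invf_lt1// ltr1n -EFinB.
rewrite /two_itv measureU//; last first.
  apply/seteqP; split => // x [/=]; rewrite !in_itv/= => /andP[_ x1] /andP[x2 _].
  have : (2^-1 : R) <= - 2^-1 by exact: le_trans x2 x1.
  by rewrite leNgt gtrN// invr_gt0.
have half : 1 - 2^-1 = 2^-1 :> R by rewrite [X in X - _](splitr 1) div1r addrK.
transitivity ((1 - 2^-1)%:E + (1 - 2^-1)%:E : \bar R)%E; first exact: congr2.
by rewrite half -EFinD -div1r -splitr.
Qed.

Definition sigma0_fun : set (measurableTypeR R) -> \bar R :=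
  fun A => (\int[mu]_(x in A) (density_two_itv x)%:E)%E.

Let sigma0_set0 : sigma0_fun set0 = 0%E.
Proof. exact: integral_set0. Qed.

Let sigma0_ge0 A : (0 <= sigma0_fun A)%E.
Proof. by apply: integral_ge0 => x _; rewrite lee_fin density_ge0. Qed.

Let sigma0_sigma_additive : semi_sigma_additive sigma0_fun.
Proof.
move=> /= F mF tF mUF; rewrite /sigma0_fun; apply: cvg_toP.
  apply: ereal_nondecreasing_is_cvgn => m n mn.
  by apply: lee_sum_nneg_natr => // k _ _; exact: sigma0_ge0.
rewrite ge0_integral_bigcup//=.
- by apply: measurable_funTS; apply: measurableT_comp => //; exact: measurable_density.
- by move=> x _; rewrite lee_fin density_ge0.
Qed.

HB.instance Definition _ := isMeasure.Build _ _ _ sigma0_fun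
  sigma0_set0 sigma0_ge0 sigma0_sigma_additive.

Let sigma0_setT : sigma0_fun setT = 1%E.
Proof.
rewrite /sigma0_fun density_indic integral_indic//; last exact: measurable_two_itv.
by rewrite setIT; exact: lebesgue_two_itv.
Qed.

HB.instance Definition _ := @Measure_isProbability.Build _ _ R
  sigma0_fun sigma0_setT.

Definition sigma0 : probability (measurableTypeR R) R := sigma0_fun.

End two_intervals.

(* Main.v *)
Require Import Defs.
From mathcomp Require Import all_boot all_order all_algebra.
From mathcomp Require Import all_classical all_reals all_analysis.
From mathcomp Require Import measurable_realfun.
From mathcomp Require Import ring lra.
Import Order.TTheory GRing.Theory Num.Theory.
Import numFieldNormedType.Exports.
Local Open Scope ring_scope.

Set Implicit Arguments.
Unset Strict Implicit.
Unset Printing Implicit Defensive.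

(** Odd [n]: testing the quadrature on a high even power of a multiple of
    [x^2 - 5/8] shows that, once the degree exceeds a multiple of [ln n], every
    node satisfies [|x^2 - 5/8| <= 1/2]. On that set the odd polynomial
    [P = x S(1 - x^2)], with [S] a Taylor polynomial of [(1 - z)^(-1/2)],
    has [P^2] exponentially close to 1, so the values [P(x_i)] sum to almost an
    odd integer; yet their mean is [E P = 0].

    Even [n]: symmetric nodes [+-(3 + y_i) / 4] reduce the claim to Bernstein's
    theorem, that the uniform measure on [[-1, 1]] has equal-weight quadratures of
    degree [K] with any number [m >= C K^2] of nodes [y_i = cos phi_i]. On an
    equispaced grid [th_j] of angles there is a positive quadrature with Fejer
    weights [lam_j]; round [m lam_j] to integers [N_j]. For a cosine polynomial [T]
    of degree [K] put
      [Phi(T) = sum_j N_j max_d (T(th_j + d) - A_j d^2 / 2) - m sum_j lam_j T(th_j)],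
    a convex function whose gradient at [T] is the defect of the quadrature with nodes
    [th_j + d_j], [d_j] being the maximisers. Hence an interior minimiser on a ball
    of a weighted norm of [T'] gives the nodes. The minimiser is interior since on the
    sphere the gain [sum_j N_j T'(th_j)^2 / A_j] beats the rounding error, which
    is at most the variation of [T]; Parseval on the grid makes both comparable to
    the norm, and bounds [T''] by [A_j / 4] near [th_j], so that the maximisers are
    unique. *)

(** * Quadratures for the two-interval measure *)

Section moments.
Context {R : realType}.
Local Notation mu := (@lebesgue_measure R).
Local Notation D := (@two_itv R).
Local Notation s0 := (@sigma0 R).

Lemma sigma0E (A : set (measurableTypeR R)) :
  s0 A = (\int[mu]_(x in A) (\1_D x : R)%:E)%E.
Proof. by rewrite /sigma0 /= /sigma0_fun; apply: eq_integral => x _; rewrite density_indic. Qed.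

Let mD1 : measurable_fun setT (fun x : measurableTypeR R => (\1_D x : R)%:E).
Proof. by apply/measurable_EFinP/measurable_indic; exact: measurable_two_itv. Qed.

Lemma sigma0_dom : s0 `<< mu.
Proof.
apply/null_content_dominatesP => A mA A0; rewrite sigma0E.
by apply: null_set_integral => //; exact: measurable_funTS.
Qed.

(** Uniqueness of the Radon-Nikodym derivative identifies the density of [s0] almost everywhere with
    [\1_D]; change of variables does the rest. *)
Lemma integral_sigma0 (f : R -> R) :
  s0.-integrable setT (EFin \o f) ->
  (\int[s0]_x (f x)%:E = \int[mu]_(x in D) (f x)%:E)%E.
Proof.
move=> If.
have mf : measurable_fun setT (EFin \o f) by exact: measurable_int If.
rewrite -(Radon_Nikodym_change_of_variables sigma0_dom)//=.
rewrite [RHS]integral_mkcond.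
transitivity (\int[mu]_x ((f x)%:E * (\1_D x : R)%:E))%E; last first.
  apply: eq_integral => x _; rewrite patchE indicE; case: ifP => xD; last by rewrite mule0.
  by rewrite mule1.
apply: ae_eq_integral => //.
- apply: emeasurable_funM => //; apply: (measurable_int mu).
  by apply: Radon_Nikodym_integrable; exact: sigma0_dom.
- by apply: emeasurable_funM.
- apply: ae_eqe_mul2l => /=.
  rewrite Radon_NikodymE//=; first exact: sigma0_dom.
  move=> abmu; case: cid => /= h [h1 h2 h3].
  apply: integral_ae_eq => //=.
  by move=> E E01 mE; rewrite -h3//= sigma0E.
Qed.

Lemma sigma0_setC : s0 (~` D)%classic = 0%E.
Proof.
have mD := @measurable_two_itv R.
rewrite sigma0E integral_indic//; last exact: measurableC.
by rewrite setICr measure0.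
Qed.

Lemma two_itv_norm x : D x -> `|x| <= 1.
Proof. by case=> /=; rewrite in_itv/= => /andP[a b]; rewrite ler_norml; lra. Qed.

Lemma integrable_sigma0 (j : nat) : s0.-integrable setT (EFin \o (fun x : R => x ^+ j)).
Proof.
have mj A : measurable_fun A (EFin \o (fun x : R => x ^+ j)).
  by apply: measurable_funTS; apply/measurable_EFinP; exact: exprn_measurable.
have mD := @measurable_two_itv R.
apply/integrableP; split; first exact: mj.
have mDC : measurable (~` D)%classic by exact: measurableC.
have mn A : measurable_fun A (fun x : R => `|(x ^+ j)%:E|%E).
  by apply: measurableT_comp => //; exact: mj.
(* [s0] gives no mass to the complement of [D], and on [D] powers are at most 1 in absolute
   value. *)
rewrite -(setvU D) setUC ge0_integral_setU//=; [|exact: mn|by rewrite disj_set2E setICr].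
rewrite [X in (_ + X)%E](_ : _ = 0%E) ?adde0; last first.
  by apply: null_set_integral => //; [exact: mn|exact: sigma0_setC].
apply: (@le_lt_trans _ _ (\int[s0]_(x in D) 1)%E).
  apply: ge0_le_integral => //=; first exact: mn.
  move=> x Dx /=; rewrite lee_fin normrX exprn_ile1//.
  exact: two_itv_norm.
rewrite integral_cst// mul1e; apply: le_lt_trans (probability_le1 _ _) _ => //.
exact: ltry.
Qed.

Lemma integral_deriv_poly (P : {poly R}) (a b : R) : a < b ->
  (\int[mu]_(x in `[a, b]%classic) (P^`().[x])%:E = (P.[b] - P.[a])%:E)%E.
Proof.
move=> ab; rewrite EFinB; apply: (@continuous_FTC2 _ (horner P^`()) (horner P)) => //.
- by apply: continuous_subspaceT; exact: continuous_horner.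
- split.
  + by move=> x _; exact: derivable_horner.
  + by apply: cvg_at_right_filter; exact: continuous_horner.
  + by apply: cvg_at_left_filter; exact: continuous_horner.
- by move=> x _; rewrite derive1E; exact: derive_val.
Qed.

(* The mean of [P^`()] under [sigma0]. *)
Definition sigma0_prim (P : {poly R}) : R := P.[1] - P.[2^-1] + (P.[- 2^-1] - P.[-1]).

Lemma moment_sigma0 (j : nat) (P : {poly R}) : P^`() = 'X^j ->
  (\int[s0]_x (x ^+ j)%:E = (sigma0_prim P)%:E)%E.
Proof.
move=> PE; rewrite integral_sigma0; last exact: integrable_sigma0.
have E x : x ^+ j = P^`().[x] :> R by rewrite PE hornerXn.
under eq_integral do rewrite E.
rewrite /two_itv integral_setU_EFin//=; first last.
- rewrite disj_set2E; apply/eqP/seteqP; split => // x /= [].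
  rewrite !in_itv/= => /andP[_ a] /andP[b _].
  by have : (2^-1 : R) <= - 2^-1 := le_trans b a; rewrite leNgt gtrN// invr_gt0.
- by apply: measurable_funTS; apply: continuous_measurable_fun; exact: continuous_horner.
by rewrite !integral_deriv_poly; [rewrite -EFinD /sigma0_prim addrC|lra|lra].
Qed.

Lemma poly_antideriv (p : {poly R}) : exists2 P : {poly R}, P^`() = p & (size P <= (size p).+1)%N.
Proof.
exists (\poly_(i < (size p).+1) (p`_i.-1 / i%:R * (i != 0%N)%:R)); last exact: size_poly.
apply/polyP => i; rewrite coef_deriv coef_poly ltnS /=.
case: ltnP => ip; last by rewrite mul0rn nth_default.
by rewrite mulr1 -[LHS]mulr_natr divfK// pnatr_eq0.
Qed.

Lemma sigma0_prim_linear : linear sigma0_prim.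
Proof. by move=> c p q; rewrite /sigma0_prim !hornerE /=; rewrite /GRing.scale/=; ring. Qed.

End moments.

(** Working with antiderivatives replaces integrals by boundary values; [size P <= k.+2] means that
    the derivative of [P] has degree at most [k]. The monomial equations extend to all such [P]
    because the error [L] is linear. *)
Lemma chebyshev_sigma0P (R : realType) (k n : nat) (x : 'I_n -> R) :
  chebyshev_quadrature (@sigma0 R) k x <->
  forall P : {poly R}, (size P <= k.+2)%N ->
    n%:R^-1 * \sum_(i < n) P^`().[x i] = sigma0_prim P.
Proof.
pose L (P : {poly R}) := n%:R^-1 * \sum_(i < n) P^`().[x i] - sigma0_prim P.
have LL c p q : L (c *: p + q) = c * L p + L q.
  rewrite /L sigma0_prim_linear /GRing.scale/=.
  rewrite (eq_bigr (fun i => c * p^`().[x i] + q^`().[x i])); last first.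
    by move=> i _; rewrite derivD derivZ !hornerE.
  by rewrite big_split/= -mulr_sumr; ring.
have L0 : L 0 = 0 by have := LL (-1) 0 0; rewrite scaler0 addr0; lra.
split=> [H P sP|H j jk].
- apply/eqP; rewrite -subr_eq0 -/(L P).
  have -> : P = \sum_(i < k.+2) P`_i *: 'X^i.
    rewrite -(poly_def _ (fun i => P`_i)).
    apply/polyP => i; rewrite coef_poly; case: ltnP => // ik.
    by rewrite nth_default// (leq_trans sP).
  have Lsum m (c : nat -> R) : L (\sum_(i < m) c i *: 'X^i) = \sum_(i < m) c i * L 'X^i.
    elim: m => [|m IH]; first by rewrite !big_ord0 L0.
    by rewrite !big_ord_recr /= addrC LL IH addrC.
  rewrite Lsum big1// => -[[|i] ik] _ /=.
    rewrite /L /sigma0_prim expr0 derivC. rewrite big1; last by move=> *; rewrite hornerE.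
    by rewrite !hornerE /=; ring.
  have i0 : (i.+1%:R : R) != 0 by rewrite pnatr_eq0.
  have D : (i.+1%:R^-1 *: 'X^(i.+1) : {poly R})^`() = 'X^i.
    by rewrite derivZ derivXn /= -(scaler_nat _ ('X^i : {poly R})) scalerA mulVf// scale1r.
  have := H i ik; rewrite (moment_sigma0 D) => -[].
  rewrite -[X in X *: 'X^(i.+1)]mulr1 => E.
  suff : i.+1%:R^-1 * L 'X^(i.+1) = 0 by move/eqP; rewrite mulf_eq0 invr_eq0 (negbTE i0)/= => /eqP ->; rewrite mulr0.
  have := LL (i.+1%:R^-1) 'X^(i.+1) 0; rewrite L0 !addr0 => <-.
  rewrite /L D -[in X in _ - X](mulr1 i.+1%:R^-1) E; apply/eqP; rewrite subr_eq0; apply/eqP.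
  by congr (_ * _); apply: eq_bigr => l _; rewrite hornerXn.
- have [P PE sP] := poly_antideriv ('X^j : {poly R}).
  rewrite (moment_sigma0 PE) -H ?PE; last by rewrite (leq_trans sP)// size_polyXn.
  by congr (_%:E); congr (_ * _); apply: eq_bigr => l _; rewrite hornerXn.
Qed.

(** * Odd numbers of nodes *)

Section odd.
Context {R : realType}.
Implicit Types (x z : R) (n N q : nat).

(** The Taylor coefficients [binom(2j, j) / 4^j] of [(1 - z)^(-1/2)], through their ratios. *)
Fixpoint invsqrt_coef (j : nat) : R :=
  if j is j'.+1 then invsqrt_coef j' * ((j'.*2.+1)%:R / (j'.*2.+2)%:R) else 1.

Arguments invsqrt_coef : simpl never.

Lemma invsqrt_coefS j :
  invsqrt_coef j.+1 = invsqrt_coef j * ((j.*2.+1)%:R / (j.*2.+2)%:R).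
Proof. by []. Qed.

Lemma invsqrt_coef_itv j : 0 <= invsqrt_coef j <= 1.
Proof.
elim: j => [|j /andP[h0 h1]]; first by rewrite /invsqrt_coef lexx ler01.
rewrite invsqrt_coefS.
have d0 : 0 < (j.*2.+2)%:R :> R by [].
rewrite mulr_ge0//=.
by rewrite mulr_ile1// ?divr_ge0// ler_pdivrMr// mul1r ler_nat.
Qed.

Definition invsqrt_poly N : {poly R} := \poly_(j < N.+1) invsqrt_coef j.

Lemma invsqrt_polyS N :
  invsqrt_poly N.+1 = invsqrt_poly N + (invsqrt_coef N.+1)%:P * 'X^(N.+1).
Proof. by rewrite /invsqrt_poly !poly_def big_ord_recr /= mul_polyC. Qed.

(** The full series satisfies [2 (1 - z) S' = S]; truncation leaves a single uncancelled
    monomial. *)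
Lemma invsqrt_poly_ode N :
  2%:P * (1 - 'X) * (invsqrt_poly N)^`() - invsqrt_poly N =
  - ((N.*2.+1)%:R * invsqrt_coef N)%:P * 'X^N.
Proof.
elim: N => [|N IH].
  rewrite /invsqrt_poly poly_def big_ord_recr big_ord0 /invsqrt_coef /= add0r expr0.
  by rewrite derivZ -(expr0 'X) derivXn/= mulr0n scaler0 mulr0 sub0r expr0 scale1r !mulr1.
have c : (2 * (N.+1)%:R) * invsqrt_coef N.+1 = (N.*2.+1)%:R * invsqrt_coef N.
  rewrite invsqrt_coefS; have -> : (N.*2.+2)%:R = 2 * (N.+1)%:R :> R by rewrite -natrM mul2n doubleS.
  have : N.+1%:R != 0 :> R by rewrite pnatr_eq0.
  by move: (N.+1%:R) (N.*2.+1)%:R => u v u0; field.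
rewrite invsqrt_polyS derivD derivM derivC mul0r add0r derivXn /=.
have -> : ('X^N *+ N.+1 : {poly R}) = (N.+1%:R)%:P * 'X^N by rewrite mul_polyC scaler_nat.
transitivity ((2%:P * (1 - 'X) * (invsqrt_poly N)^`() - invsqrt_poly N) +
  (2 * N.+1%:R * invsqrt_coef N.+1)%:P * 'X^N
  - ((N.*2.+3)%:R * invsqrt_coef N.+1)%:P * 'X^(N.+1)).
  have -> : (N.*2.+3)%:R = 2 * N.+1%:R + 1 :> R.
    by rewrite -natrM natr1 mul2n doubleS.
  by rewrite !(rmorphM, rmorphD, rmorph1) exprS /=; ring.
by rewrite IH c doubleS; ring.
Qed.

(** Equal to 1 for the untruncated series; at [z = 1 - x^2] it is [(x S(1 - x^2))^2]. *)
Definition defect N : {poly R} := (1 - 'X) * invsqrt_poly N ^+ 2.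

Lemma deriv_defect N : (defect N)^`() =
  - ((N.*2.+1)%:R * invsqrt_coef N)%:P * 'X^N * invsqrt_poly N.
Proof.
rewrite -invsqrt_poly_ode /defect expr2 !derivM derivB derivX -polyC1 derivC polyC1.
by rewrite (_ : 2%:P = 1 + 1 :> {poly R}) ?polyCD//; ring.
Qed.

(** The coefficients lie in [[0, 1]], so the geometric series of ratio 7/8, with sum 8,
    dominates. *)
Lemma invsqrt_poly_le8 N z : `|z| <= 7 / 8 -> `|(invsqrt_poly N).[z]| <= 8.
Proof.
move=> zle; rewrite horner_poly.
apply: le_trans (ler_norm_sum _ _ _) _.
suff : \sum_(j < N.+1) `|invsqrt_coef j * z ^+ j| <= 8 * (1 - (7 / 8) ^+ N.+1).
  have : 0 <= (7 / 8 : R) ^+ N.+1 by apply: exprn_ge0; lra.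
  lra.
elim: N.+1 => [|m IH]; first by rewrite big_ord0 expr0; lra.
rewrite big_ord_recr /= exprS.
have : `|invsqrt_coef m * z ^+ m| <= (7 / 8) ^+ m.
  have /andP[c0 c1] := invsqrt_coef_itv m.
  rewrite normrM (ger0_norm c0) -[leRHS]mul1r ler_pM// normrX lerXn2r// ?nnegrE//; lra.
lra.
Qed.

Lemma horner_MVT (P : {poly R}) (a b : R) : a <= b ->
  exists2 c, a <= c <= b & P.[b] - P.[a] = P^`().[c] * (b - a).
Proof.
move=> ab; have [|c cab E] := @MVT_segment R (horner P) (horner P^`()) a b ab (fun x _ => is_derive_poly P x).
  by apply: continuous_subspaceT; exact: continuous_horner.
by exists c => //; move: cab; rewrite in_itv.
Qed.

(** [defect N] is 1 at 0 and its derivative carries a factor [z^N], exponentially small on this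
    disc; the mean value theorem concludes. *)
Lemma defect_bound N z : `|z| <= 7 / 8 ->
  `|(defect N).[z] - 1| <= 8 * (N.*2.+1)%:R * (7 / 8) ^+ N.
Proof.
move=> zle.
have D0 : (defect N).[0] = 1.
  rewrite /defect !hornerE horner_poly big_ord_recl /= big1 => [|i _].
    by rewrite /invsqrt_coef /= expr0; ring.
  by rewrite exprS mul0r mulr0.
have dB c : `|c| <= 7 / 8 -> `|(defect N)^`().[c]| <= 8 * (N.*2.+1)%:R * (7 / 8) ^+ N.
  move=> cle; rewrite deriv_defect !hornerE !normrM normrN normrM.
  have /andP[c0 c1] := invsqrt_coef_itv N.
  rewrite normr_nat (ger0_norm c0) [leRHS]mulrC mulrA [leRHS]mulrAC.
  rewrite ler_pM ?mulr_ge0 ?normr_ge0//; last exact: invsqrt_poly_le8.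
  rewrite mulrC ler_pM ?mulr_ge0 ?normr_ge0//.
    by rewrite normrX lerXn2r// ?nnegrE//; lra.
  by rewrite -[leRHS]mulr1 ler_wpM2l.
have B0 : 0 <= 8 * (N.*2.+1)%:R * (7 / 8) ^+ N :> R.
  by rewrite !mulr_ge0// exprn_ge0//; lra.
have key c : `|c| <= `|z| ->
    `|(defect N)^`().[c] * z| <= 8 * (N.*2.+1)%:R * (7 / 8) ^+ N.
  move=> cz; rewrite normrM -[leRHS]mulr1 ler_pM ?normr_ge0//; last by lra.
  by apply: dB; lra.
rewrite -[X in _ - X]D0; have [z0|z0] := lerP 0 z.
  have [c /andP[c0 c1] ->] := horner_MVT (defect N) z0; rewrite subr0 key//.
  by rewrite !ger0_norm.
have [c /andP[c0 c1] E] := horner_MVT (defect N) (ltW z0).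
rewrite distrC E sub0r mulrN normrN key//.
by rewrite ler0_norm// ltr0_norm// lerN2.
Qed.

(** Replacing each [s i] by its sign moves the sum by at most [n e], while a sum of an odd number of
    signs is an odd integer. *)
Lemma odd_sum_sign (n : nat) (s : 'I_n -> R) (e : R) : odd n ->
  (forall i, `|s i ^+ 2 - 1| <= e) -> \sum_i s i = 0 -> 1 <= n%:R * e.
Proof.
move=> on se s0.
pose b i := 0 <= s i.
pose g i : R := (b i)%:R * 2 - 1.
(* For [g] the sign of [s] one has [|s + g| >= 1], hence [|s - g| <= |s^2 - 1|]. *)
have gs i : `|g i - s i| <= e.
  apply: le_trans (se i).
  have [h|h] := boolP (b i); rewrite /g ?h ?(negbTE h) /= ?mul1r ?mul0r.
    have -> : s i ^+ 2 - 1 = (s i - 1) * (s i + 1) by ring.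
    have si0 : 0 <= s i by [].
    rewrite normrM distrC (_ : 2 - 1 = 1); last by ring.
    by rewrite ler_peMr ?normr_ge0// ger0_norm; lra.
  have si0 : s i < 0 by rewrite ltNge.
  have -> : s i ^+ 2 - 1 = (- 1 - s i) * (1 - s i) by ring.
  by rewrite normrM sub0r ler_peMr ?normr_ge0// ger0_norm; lra.
have : `|\sum_i g i| <= n%:R * e.
  have -> : \sum_i g i = \sum_i (g i - s i) by rewrite [RHS]sumrB s0 subr0.
  apply: le_trans (ler_norm_sum _ _ _) _.
  apply: le_trans (ler_sum _ (fun i _ => gs i)) _.
  by rewrite sumr_const card_ord mulr_natl.
apply: le_trans.
have -> : \sum_i g i = ((\sum_i (b i : nat))%:Z * 2 - n%:Z)%:~R.
  rewrite rmorphB rmorphM /= -!pmulrn sumrB -mulr_suml natr_sum.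
  by rewrite sumr_const card_ord.
set p := (\sum_i _)%N.
rewrite -intr_norm (_ : 1 = 1%:~R) // ler_int.
have : p%:Z * 2 - n%:Z != 0.
  apply/eqP => h.
  have : (p * 2)%N = n by apply/eqP; rewrite -eqz_nat PoszM -subr_eq0; apply/eqP.
  by move=> pn; move: on; rewrite -pn oddM andbF.
by rewrite -normr_gt0 -gtz0_ge1.
Qed.

End odd.

(** * Logarithmic degree bound for odd numbers of nodes *)

Section odd_main.
Context {R : realType}.
Implicit Types (n k q : nat).

(** The nonnegative polynomial [u^(2q)] has mean at most 1, so none of its node values exceeds [n].
    A node with [|x^2 - 5/8| > 1/2] would have [u^2 > 16/9 > 9/8]. *)
Lemma quadrature_node_itv n k (x : 'I_n -> R) q :
  chebyshev_quadrature (@sigma0 R) k x -> (4 * q < k)%N ->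
  n%:R < (9 / 8 : R) ^+ q ->
  forall i, `|x i ^+ 2 - 5 / 8| <= 1 / 2.
Proof.
move=> /chebyshev_sigma0P quad qk nq i.
(* The factor 8/3 makes [u] run through [[-1, 1]] as [t^2] runs through [[1/4, 1]], its range on the
   support. *)
pose u (t : R) := (t ^+ 2 - 5 / 8) * (8 / 3).
pose U : {poly R} := ('X^2 - (5 / 8)%:P) * (8 / 3)%:P.
pose A := U ^+ (2 * q).
have UE t : U.[t] = u t by rewrite /U /u !hornerE.
have AE t : A.[t] = u t ^+ (2 * q) by rewrite /A horner_exp UE.
have sA : (size A <= k)%N.
  rewrite /A (leq_trans (size_poly_exp_leq _ _))//.
  have sU : ((size U).-1 <= 2)%N.
    by rewrite -subn1 leq_subLR /U mulrC mul_polyC (leq_trans (size_scale_leq _ _))// size_XnsubC.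
  by rewrite (leq_ltn_trans _ qk)// (leq_trans (leq_mul sU (leqnn _)))// mulnA.
have [P PE sP] := poly_antideriv A.
have := quad P; rewrite PE => /(_ (leq_trans sP _)) => E.
have {}E : n%:R^-1 * \sum_(i < n) A.[x i] = sigma0_prim P.
  by apply: E; rewrite ltnS (leq_trans sA)// leqnSn.
have n0 : 0 < n%:R :> R by rewrite ltr0n; case: (n) i => // -[].
have Ale (c : R) : 1 / 4 <= c ^+ 2 <= 1 -> A.[c] <= 1.
  move=> /andP[c1 c2]; rewrite AE; apply: le_trans (ler_norm _) _.
  by rewrite normrX exprn_ile1// /u ler_norml; lra.
have prim1 : sigma0_prim P <= 1.
  rewrite /sigma0_prim.
  have [|c /andP[ca cb] ->] := @horner_MVT _ P (2^-1) 1; first lra.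
  have [|d /andP[da db] ->] := @horner_MVT _ P (-1) (- 2^-1); first lra.
  have Ac : A.[c] <= 1 by apply: Ale; nra.
  have Ad : A.[d] <= 1 by apply: Ale; nra.
  rewrite PE; lra.
have Age0 (c : R) : 0 <= A.[c] by rewrite AE exprM exprn_ge0// sqr_ge0.
have Ai : A.[x i] <= n%:R.
  have : \sum_(i < n) A.[x i] <= n%:R.
    by move: prim1; rewrite -E ler_pdivrMl// mulr1.
  apply: le_trans; rewrite (bigD1 i)//= lerDl sumr_ge0//.
rewrite leNgt; apply/negP => h.
suff : (9 / 8) ^+ q <= A.[x i] by lra.
rewrite AE exprM lerXn2r// ?nnegrE ?sqr_ge0//.
rewrite -real_normK ?num_real// /u normrM [`|8 / 3|]ger0_norm; last lra.
nra.
Qed.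

Lemma even_prim (P : {poly R}) : (forall x, P^`().[- x] = - P^`().[x]) ->
  sigma0_prim P = 0.
Proof.
move=> Podd.
have PN x : P.[- x] = P.[x].
  have H y : is_derive y (1 : R) (fun y => P.[- y] - P.[y]) 0.
    have h1 : is_derive y (1 : R) (horner P \o -%R) (P^`().[- y] * - 1).
      exact: is_derive1_comp.
    by apply: is_derive_eq; rewrite Podd; ring.
  have := @is_derive_0_is_cst R _ x 0 H.
  by rewrite /= oppr0 subrr => /eqP; rewrite subr_eq0 => /eqP.
by rewrite /sigma0_prim !PN; ring.
Qed.

Lemma odd_degree_bound n k (x : 'I_n -> R) q : odd n ->
  chebyshev_quadrature (@sigma0 R) k x -> (4 * q < k)%N ->
  (9 / 8 : R) ^+ q <= 256 * n%:R.
Proof.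
move=> on quad qk; rewrite leNgt; apply/negP => nq.
have n1 : 1 <= n%:R :> R by rewrite ler1n; case: (n) on.
have node i : `|x i ^+ 2 - 5 / 8| <= 1 / 2.
  by apply: (quadrature_node_itv quad qk); lra.
(* With this [N] the test polynomial has degree at most [2 N + 1 = 4 q + 1 <= k]. *)
pose N := (2 * q)%N.
pose P : {poly R} := 'X * (invsqrt_poly N \Po (1 - 'X^2)).
have PE t : P.[t] = t * (invsqrt_poly N).[1 - t ^+ 2].
  by rewrite /P !hornerE horner_comp !hornerE.
have sP : (size P <= k.+1)%N.
  rewrite /P (leq_trans (size_polyMleq _ _))// size_polyX add2n /= ltnS.
  rewrite (leq_trans (size_comp_poly_leq _ _))//.
  have s1 : ((size (invsqrt_poly N : {poly R})).-1 <= N)%N.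
    by rewrite -subn1 leq_subLR add1n size_poly.
  have s2 : ((size (1 - 'X^2 : {poly R})%R).-1 <= 2)%N.
    by rewrite -subn1 leq_subLR -opprB size_polyN -polyC1 size_XnsubC.
  by rewrite (leq_ltn_trans (leq_mul s1 s2))// /N mulnC mulnA.
have [A AE sA] := poly_antideriv P.
have S0 : \sum_(i < n) P.[x i] = 0.
  have := quad; move=> /chebyshev_sigma0P/(_ A); rewrite AE even_prim; last first.
    by move=> t; rewrite AE !PE sqrrN mulNr.
  move=> /(_ (leq_trans sA _)) => E.
  have := E sP => /eqP; rewrite mulf_eq0 invr_eq0 => /orP[/eqP n0|/eqP//].
  by lra.
have dev i : `|P.[x i] ^+ 2 - 1| <= 8 * (N.*2.+1)%:R * (7 / 8) ^+ N.
  have -> : P.[x i] ^+ 2 = (defect N).[1 - x i ^+ 2].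
    by rewrite PE /defect !hornerE /=; ring.
  (* The nodes satisfy [1/8 <= x^2 <= 9/8], so [|1 - x^2| <= 7/8], the radius in [defect_bound]. *)
  by apply: defect_bound; have := node i; rewrite !ler_norml; lra.
have := odd_sum_sign on dev S0.
rewrite leNgt => /negP; apply.
have Nq : (N.*2.+1)%:R <= 32 * (9 / 8) ^+ q :> R.
  have -> : (N.*2.+1)%:R = 4 * q%:R + 1 :> R.
    by rewrite -(natr1 N.*2) /N -muln2 !natrM; ring.
  elim: (q) => [|r IH]; first by rewrite expr0 mulr0; lra.
  have : 1 <= (9 / 8 : R) ^+ r by apply: exprn_ege1; lra.
  by rewrite exprS -(natr1 r); lra.
pose a : R := (9 / 8) ^+ q; pose b : R := (7 / 8) ^+ N.
have b0 : 0 < b by rewrite exprn_gt0//; lra.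
have a0 : 0 < a by rewrite exprn_gt0//; lra.
(* Since [(9/8)(7/8) = 63/64 < 1], the truncation error [b] beats the two factors of order [a] that
   bound [n] and [2 N + 1]. *)
have ab : a ^+ 2 * b <= 1.
  by rewrite /a /b /N exprAC exprM -exprMn exprn_ile1//; lra.
rewrite -/a -/b in nq Nq *.
have nN : n%:R * (N.*2.+1)%:R * b < 1 / 8.
  have : n%:R * (N.*2.+1)%:R * b <= n%:R * (32 * a) * b :> R.
    by rewrite (ler_wpM2r (ltW b0))// ler_wpM2l.
  have an : 0 < a - 256 * n%:R by rewrite subr_gt0; exact: nq.
  have := mulr_gt0 an (mulr_gt0 a0 b0).
  lra.
lra.
Qed.

Lemma odd_degree_ln n k (x : 'I_n -> R) : odd n ->
  chebyshev_quadrature (@sigma0 R) k x -> k%:R <= 256 * ln (256 * n%:R) :> R.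
Proof.
move=> on quad.
have n1 : 1 <= n%:R :> R by rewrite ler1n; case: (n) on.
have lnge (y : R) : 0 < y -> 1 - y^-1 <= ln y.
  move=> y0; have := expR_ge1Dx (- ln y).
  by rewrite expRN lnK ?posrE//; lra.
(* This lower bound absorbs the additive 4 in [k <= 4 q + 4] and settles [k = 0]. *)
have l1 : 99 / 100 <= ln (256 * n%:R) :> R.
  apply: le_trans (lnge _ _); last by lra.
  suff : (256 * n%:R)^-1 <= 1 / 100 :> R by lra.
  by rewrite div1r lef_pV2 ?posrE; lra.
have [->|k0] := posnP k; first by rewrite mulr0n; lra.
pose q := (k.-1 %/ 4)%N.
have qk : (4 * q < k)%N by rewrite -[ltnRHS]prednK// ltnS mulnC leq_trunc_div.
have kq : (k <= 4 * q + 4)%N.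
  by rewrite -[leqLHS]prednK// -mulnSr mulnC ltn_ceil.
have := odd_degree_bound on quad qk.
have q9 : 0 < (9 / 8 : R) ^+ q by apply: exprn_gt0; lra.
rewrite -ler_ln ?posrE; [|exact: q9|lra].
rewrite lnXn; last lra.
have l9 := lnge (9 / 8); rewrite -[_ *+ q]mulr_natr => lq.
have : k%:R <= 4 * q%:R + 4 :> R by rewrite -natrM -natrD ler_nat.
have q0 : 0 <= q%:R :> R by [].
have {}l9 : 1 / 9 <= ln (9 / 8) :> R.
  by have := l9; rewrite invf_div; lra.
have := ler_wpM2r q0 l9.
lra.
Qed.
End odd_main.

(** * Trigonometric polynomials on a grid *)

Section trig.
Context {R : realType}.
Implicit Types (d k l n Q : nat) (t x y : R).

Lemma sinM_cos x y : sin x * cos y = (sin (x - y) + sin (x + y)) / 2 :> R.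
Proof. by rewrite sinB sinD; field. Qed.

Definition grid Q t (j : nat) : R := j%:R * (2 * pi / Q%:R) + t.

Definition gmean Q t (g : R -> R) : R := Q%:R^-1 * \sum_(j < Q) g (grid Q t j).

Lemma sinDn2pi x n : sin (x + n%:R * (2 * pi)) = sin x.
Proof. by rewrite (mulr_natl _ n) (mulr_natl _ 2) (periodicn (@sinD2pi R)). Qed.

Lemma cosDn2pi x n : cos (x + n%:R * (2 * pi)) = cos x.
Proof. by rewrite (mulr_natl _ n) (mulr_natl _ 2) (periodicn (@cosD2pi R)). Qed.

Lemma sin_half_step Q n : (0 < n < Q)%N -> 0 < sin (n%:R * (pi / Q%:R)) :> R.
Proof.
move=> /andP[n0 nQ]; apply: sin_gt0_pi.
have p0 := @pi_gt0 R.
have Q0 : 0 < Q%:R :> R by rewrite ltr0n (leq_trans _ nQ).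
have n0' : 0 < n%:R :> R by rewrite ltr0n.
apply/andP; split; first by rewrite mulr_gt0// divr_gt0.
by rewrite mulrA ltr_pdivrMr// mulrC ltr_pM2l// ltr_nat.
Qed.

(** Multiplying by [2 sin u], with [u] half the phase step, makes the sum telescope between phases
    that differ by a multiple of [2 pi]; [0 < n < Q] keeps [sin u] nonzero. *)
Lemma gmean_cos Q t n : (0 < n < Q)%N -> gmean Q t (fun x => cos (n%:R * x)) = 0.
Proof.
move=> nQ; have s0 := sin_half_step nQ.
have Q0 : Q%:R != 0 :> R by rewrite pnatr_eq0; case: (Q) nQ => //; rewrite andbF.
set u := n%:R * (pi / Q%:R) in s0 *.
pose f j := sin (n%:R * grid Q t j - u).
have fE j : f j.+1 - f j = cos (n%:R * grid Q t j) * (2 * sin u).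
  rewrite /f /grid -(natr1 j).
  have -> : n%:R * ((j%:R + 1) * (2 * pi / Q%:R) + t) - u =
     n%:R * (j%:R * (2 * pi / Q%:R) + t) + u by rewrite /u; field.
  by rewrite sinB sinD; ring.
have : \sum_(j < Q) cos (n%:R * grid Q t j) * (2 * sin u) = 0.
  under eq_bigr do rewrite -fE.
  rewrite -(big_mkord xpredT (fun j => f j.+1 - f j)) telescope_sumr// /f /grid.
  rewrite mul0r add0r (_ : n%:R * _ - u = n%:R * t - u + n%:R * (2 * pi)); last by field.
  by rewrite sinDn2pi subrr.
rewrite -mulr_suml => /eqP; rewrite mulf_eq0 mulf_eq0 pnatr_eq0/= (gt_eqF s0) orbF.
by move=> /eqP E; rewrite /gmean E mulr0.
Qed.

Lemma gmean_sin Q t n : (0 < n < Q)%N -> gmean Q t (fun x => sin (n%:R * x)) = 0.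
Proof.
move=> nQ; have s0 := sin_half_step nQ.
have Q0 : Q%:R != 0 :> R by rewrite pnatr_eq0; case: (Q) nQ => //; rewrite andbF.
set u := n%:R * (pi / Q%:R) in s0 *.
pose f j := - cos (n%:R * grid Q t j - u).
have fE j : f j.+1 - f j = sin (n%:R * grid Q t j) * (2 * sin u).
  rewrite /f /grid -(natr1 j).
  have -> : n%:R * ((j%:R + 1) * (2 * pi / Q%:R) + t) - u =
     n%:R * (j%:R * (2 * pi / Q%:R) + t) + u by rewrite /u; field.
  by rewrite cosB cosD; ring.
have : \sum_(j < Q) sin (n%:R * grid Q t j) * (2 * sin u) = 0.
  under eq_bigr do rewrite -fE.
  rewrite -(big_mkord xpredT (fun j => f j.+1 - f j)) telescope_sumr// /f /grid.
  rewrite mul0r add0r (_ : n%:R * _ - u = n%:R * t - u + n%:R * (2 * pi)); last by field.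
  by rewrite cosDn2pi subrr.
rewrite -mulr_suml => /eqP; rewrite mulf_eq0 mulf_eq0 pnatr_eq0/= (gt_eqF s0) orbF.
by move=> /eqP E; rewrite /gmean E mulr0.
Qed.

Lemma gmeanD Q t f g : gmean Q t (fun x => f x + g x) = gmean Q t f + gmean Q t g.
Proof. by rewrite /gmean big_split mulrDr. Qed.

Lemma gmeanZ Q t c f : gmean Q t (fun x => c * f x) = c * gmean Q t f.
Proof. by rewrite /gmean -mulr_sumr; ring. Qed.

Lemma eq_gmean Q t f g : f =1 g -> gmean Q t f = gmean Q t g.
Proof. by move=> fg; rewrite /gmean; congr (_ * _); apply: eq_bigr => *; rewrite fg. Qed.

Lemma gmean_sum Q t (I : finType) (F : I -> R -> R) :
  gmean Q t (fun x => \sum_i F i x) = \sum_i gmean Q t (F i).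
Proof. by rewrite /gmean exchange_big /= mulr_sumr. Qed.

Lemma gmean_cst Q t c : (0 < Q)%N -> gmean Q t (fun=> c) = c.
Proof.
move=> Q0; rewrite /gmean sumr_const card_ord -[c *+ Q]mulr_natl mulKf//.
by rewrite pnatr_eq0 -lt0n.
Qed.

Definition trig_term (a b : nat -> R) k x := a k * cos (k%:R * x) + b k * sin (k%:R * x).

(** The mean square of [trig_term a b k]; only the zero frequency escapes the factor 1/2. *)
Definition trig_energy (a b : nat -> R) k : R :=
  if k is 0 then a 0 ^+ 2 else (a k ^+ 2 + b k ^+ 2) / 2.

Lemma gmean_term_neq Q t a b k l : (l < k)%N -> (k + l < Q)%N ->
  gmean Q t (fun x => trig_term a b k x * trig_term a b l x) = 0.
Proof.
move=> lk kl.
rewrite (@eq_gmean _ _ _ (fun x =>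
  (a k * a l + b k * b l) / 2 * cos ((k - l)%:R * x) +
  ((a k * a l - b k * b l) / 2 * cos ((k + l)%:R * x) +
  ((b k * a l - a k * b l) / 2 * sin ((k - l)%:R * x) +
  (b k * a l + a k * b l) / 2 * sin ((k + l)%:R * x))))); last first.
  move=> x; by rewrite /trig_term (natrB _ (ltnW lk)) (natrD _ k l) (mulrBl x) (mulrDl _ _ x) cosB cosD sinB sinD; field.
have k1 : (0 < k - l < Q)%N by rewrite subn_gt0 lk (leq_ltn_trans _ kl)// (leq_trans (leq_subr _ _)) ?leq_addr.
have k2 : (0 < k + l < Q)%N by rewrite kl andbT (leq_ltn_trans _ (leq_trans lk (leq_addr _ _))).
by rewrite !gmeanD !gmeanZ !gmean_cos// !gmean_sin// !mulr0 !addr0.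
Qed.

Lemma gmean_term_sqr Q t a b k : (2 * k < Q)%N ->
  gmean Q t (fun x => trig_term a b k x ^+ 2) = trig_energy a b k.
Proof.
case: k => [|k] kQ.
  rewrite (@eq_gmean _ _ _ (fun=> a 0%N ^+ 2)) ?gmean_cst// => x.
  by rewrite /trig_term mul0r cos0 sin0 mulr0 mulr1 addr0.
rewrite (@eq_gmean _ _ _ (fun x =>
  (a k.+1 ^+ 2 + b k.+1 ^+ 2) / 2 +
  ((a k.+1 ^+ 2 - b k.+1 ^+ 2) / 2 * cos ((2 * k.+1)%:R * x) +
  (a k.+1 * b k.+1) * sin ((2 * k.+1)%:R * x)))); last first.
  move=> x; rewrite /trig_term; set y := k.+1%:R * x.
  have -> : (2 * k.+1)%:R * x = y + y by rewrite natrM /y; ring.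
  rewrite cosD sinD.
  have E := cos2Dsin2 y.
  have -> : (a k.+1 ^+ 2 + b k.+1 ^+ 2) / 2 = (a k.+1 ^+ 2 + b k.+1 ^+ 2) / 2 * (cos y ^+ 2 + sin y ^+ 2).
    by rewrite E mulr1.
  by field.
rewrite !gmeanD !gmeanZ gmean_cst ?(leq_ltn_trans _ kQ)// gmean_cos ?gmean_sin ?kQ//.
by rewrite !mulr0 !addr0.
Qed.

Definition trig_poly d (a b : nat -> R) x : R := \sum_(k < d.+1) trig_term a b k x.

(** Products of two terms have frequencies at most [2 d < Q], so the grid does not alias them and
    distinct terms are orthogonal. The right-hand side is free of the offset [t], the source of all
    shift invariance below. *)
Lemma parseval d Q t a b : (2 * d < Q)%N ->
  gmean Q t (fun x => trig_poly d a b x ^+ 2) = \sum_(k < d.+1) trig_energy a b k.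
Proof.
move=> dQ.
rewrite (@eq_gmean _ _ _ (fun x => \sum_(k < d.+1) \sum_(l < d.+1)
  trig_term a b k x * trig_term a b l x)); last first.
  by move=> x; rewrite /trig_poly expr2 big_distrlr.
rewrite gmean_sum; apply: eq_bigr => k _; rewrite gmean_sum (bigD1 k)//= big1 ?addr0.
  have kQ : (2 * k < Q)%N by rewrite (leq_ltn_trans _ dQ)// leq_mul2l -ltnS ltn_ord orbT.
  by rewrite -(gmean_term_sqr t a b kQ).
move=> l lk.
have kl : (k + l < Q)%N.
  by rewrite (leq_ltn_trans _ dQ)// mul2n -addnn leq_add// -ltnS.
have [kl'|kl'|/val_inj kl'] := ltngtP k l; last by rewrite kl' eqxx in lk.
  rewrite -(@gmean_term_neq Q t a b _ _ kl') 1?addnC//.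
  by apply: eq_gmean => x; rewrite mulrC.
by rewrite gmean_term_neq.
Qed.

(** Cauchy-Schwarz without square roots, by induction; the cross term uses
    [4 (m E) (M e) <= (m E + M e)^2]. *)
Lemma sum_sqr_le (I : Type) (s : seq I) (u m e : I -> R) :
  (forall i, 0 <= m i) -> (forall i, 0 <= e i) ->
  (forall i, u i ^+ 2 <= m i * e i) ->
  (\sum_(i <- s) u i) ^+ 2 <= (\sum_(i <- s) m i) * (\sum_(i <- s) e i).
Proof.
move=> m0 e0 ume.
suff : [/\ 0 <= \sum_(i <- s) m i, 0 <= \sum_(i <- s) e i & 
  (\sum_(i <- s) u i) ^+ 2 <= (\sum_(i <- s) m i) * (\sum_(i <- s) e i)] by case.
elim: s => [|i s [M0 E0 IH]]; first by rewrite !big_nil expr0n mulr0; split.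
rewrite !big_cons; split; rewrite ?addr_ge0//.
set x := \sum_(j <- s) u j in IH *; set M := \sum_(j <- s) m j in M0 IH *.
set E := \sum_(j <- s) e j in E0 IH *.
have h : 2 * (u i * x) <= m i * E + M * e i.
  apply: le_trans (ler_norm _) _.
  rewrite -(ler_pXn2r (n := 2))// ?nnegrE ?addr_ge0 ?mulr_ge0//.
  have sq := sqr_ge0 (m i * E - M * e i).
  rewrite real_normK ?num_real//.
  have : (u i ^+ 2) * (x ^+ 2) <= (m i * e i) * (M * E) by rewrite ler_pM ?sqr_ge0.
  by nra.
have := ume i; nra.
Qed.

End trig.

(** * Sup bounds for trigonometric polynomials and their derivatives *)

Section trig2.
Context {R : realType}.
Implicit Types (d k l n Q : nat) (t x y : R).

Lemma is_derive_fsum n (f : 'I_n -> R -> R) (df : 'I_n -> R) x :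
  (forall i, is_derive x 1 (f i) (df i)) ->
  is_derive x 1 (fun y => \sum_(i < n) f i y) (\sum_(i < n) df i).
Proof.
move=> H; have -> : (fun y => \sum_(i < n) f i y) = \sum_(i < n) f i.
  by apply/funext => y; rewrite fct_sumE.
exact: is_derive_sum.
Qed.

Lemma is_derive_cosM (c x : R) : is_derive x 1 (fun y => cos (c * y)) (- c * sin (c * x)).
Proof.
have h1 : is_derive x (1 : R) (fun y => c * y) c.
  by apply: is_derive_eq (is_deriveZ _ (is_derive_id x 1)) _; rewrite /GRing.scale/= mulr1.
have h2 := is_derive_cos (c * x).
by apply: (is_derive_eq (is_derive1_comp h2 h1)); ring.
Qed.

Lemma is_derive_sinM (c x : R) : is_derive x 1 (fun y => sin (c * y)) (c * cos (c * x)).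
Proof.
have h1 : is_derive x (1 : R) (fun y => c * y) c.
  by apply: is_derive_eq (is_deriveZ _ (is_derive_id x 1)) _; rewrite /GRing.scale/= mulr1.
have h2 := is_derive_sin (c * x).
by apply: (is_derive_eq (is_derive1_comp h2 h1)); ring.
Qed.

Lemma is_derive_scale (c x df : R) (f : R -> R) :
  is_derive x 1 f df -> is_derive x 1 (fun y => c * f y) (c * df).
Proof. exact: is_deriveZ. Qed.

Definition is_trig d (V : R -> R) := exists a b, V =1 trig_poly d a b.

Lemma is_trig_ext d V W : V =1 W -> is_trig d V -> is_trig d W.
Proof. by move=> VW [a [b E]]; exists a, b => x; rewrite -VW. Qed.

Lemma is_trigD d V W : is_trig d V -> is_trig d W -> is_trig d (fun x => V x + W x).
Proof.
move=> [a [b E]] [a' [b' E']]; exists (fun k => a k + a' k), (fun k => b k + b' k) => x.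
rewrite E E' /trig_poly -big_split; apply: eq_bigr => k _ /=.
by rewrite /trig_term; ring.
Qed.

Lemma is_trigZ d c V : is_trig d V -> is_trig d (fun x => c * V x).
Proof.
move=> [a [b E]]; exists (fun k => c * a k), (fun k => c * b k) => x.
rewrite E /trig_poly mulr_sumr; apply: eq_bigr => k _ /=.
by rewrite /trig_term; ring.
Qed.

Lemma is_trig_cos d k : (k <= d)%N -> is_trig d (fun x => cos (k%:R * x)).
Proof.
move=> kd; exists (fun i => (i == k)%:R), (fun=> 0) => x.
have kd' : (k < d.+1)%N by [].
rewrite /trig_poly (bigD1 (Ordinal kd'))//= big1 => [|i ik].
  by rewrite /trig_term eqxx mulr1n; ring.
rewrite /trig_term (_ : (i : nat) == k = false) ?mulr0n; first by ring.
by apply/negbTE; apply: contra ik => /eqP ik; apply/eqP/val_inj.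
Qed.

Lemma is_trig_sin d k : (k <= d)%N -> is_trig d (fun x => sin (k%:R * x)).
Proof.
move=> kd; exists (fun=> 0), (fun i => (i == k)%:R) => x.
have kd' : (k < d.+1)%N by [].
rewrite /trig_poly (bigD1 (Ordinal kd'))//= big1 => [|i ik].
  by rewrite /trig_term eqxx mulr1n; ring.
rewrite /trig_term (_ : (i : nat) == k = false) ?mulr0n; first by ring.
by apply/negbTE; apply: contra ik => /eqP ik; apply/eqP/val_inj.
Qed.

Lemma is_trig_sum d (I : Type) (s : seq I) (F : I -> R -> R) :
  (forall i, is_trig d (F i)) -> is_trig d (fun x => \sum_(i <- s) F i x).
Proof.
move=> H; elim: s => [|i s IH].
  apply: (@is_trig_ext _ (fun x => 0 * cos (0%:R * x))).
    by move=> x; rewrite big_nil mul0r.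
  exact/is_trigZ/is_trig_cos.
apply: (is_trig_ext _ (is_trigD (H i) IH)) => x.
by rewrite big_cons.
Qed.

(** Product-to-sum formulas. This brings the weight [sin^2] within reach of Parseval. *)
Lemma is_trig_Msin d V : is_trig d V -> is_trig d.+1 (fun x => V x * sin x).
Proof.
move=> [a [b E]].
have H (k : 'I_d.+1) : is_trig d.+1 (fun x => trig_term a b k x * sin x).
  case: k => -[|k] kd /=.
    apply: (@is_trig_ext _ (fun x => a 0%N * sin (1%:R * x))).
      by move=> x; rewrite /trig_term mul0r cos0 sin0 mul1r; ring.
    exact/is_trigZ/is_trig_sin.
  apply: (@is_trig_ext _ (fun x => a k.+1 / 2 * sin (k.+2%:R * x) +
    (- (a k.+1 / 2) * sin (k%:R * x) +
    (b k.+1 / 2 * cos (k%:R * x) + - (b k.+1 / 2) * cos (k.+2%:R * x))))).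
    move=> x; rewrite /trig_term -(natr1 k.+1) -(natr1 k).
    have -> : (k%:R + 1 + 1) * x = (k%:R + 1) * x + x by ring.
    have -> : k%:R * x = (k%:R + 1) * x - x by ring.
    set y := (k%:R + 1) * x.
    by rewrite (sinD y x) (cosD y x) (sinB y x) (cosB y x); field.
  have kd2 : (k <= d.+1)%N by rewrite ltnW// ltnW.
  do ?apply: is_trigD; apply: is_trigZ; by [exact: is_trig_sin|exact: is_trig_cos].
apply: (is_trig_ext _ (@is_trig_sum _ _ (index_enum _) _ H)) => x.
by rewrite E /trig_poly mulr_suml.
Qed.

Lemma gmean_sqr_shift d Q t s V : (2 * d < Q)%N -> is_trig d V ->
  gmean Q t (fun x => V x ^+ 2) = gmean Q s (fun x => V x ^+ 2).
Proof.
move=> dQ [a [b E]].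
by rewrite !(@eq_gmean _ _ _ (fun x => V x ^+ 2) (fun x => trig_poly d a b x ^+ 2))
  ?parseval// => x; rewrite E.
Qed.

Lemma trig_energy_ge0 (a b : nat -> R) k : 0 <= trig_energy a b k.
Proof. by case: k => [|k]; rewrite /trig_energy ?sqr_ge0// divr_ge0// addr_ge0 ?sqr_ge0. Qed.

Lemma sqr_cos_sin (u v x : R) : (u * cos x + v * sin x) ^+ 2 <= u ^+ 2 + v ^+ 2.
Proof.
have := cos2Dsin2 x; set c := cos x; set s := sin x => E.
have : u ^+ 2 + v ^+ 2 - (u * c + v * s) ^+ 2 = (u * s - v * c) ^+ 2.
  have -> : u ^+ 2 + v ^+ 2 = (u ^+ 2 + v ^+ 2) * (c ^+ 2 + s ^+ 2) by rewrite E mulr1.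
  by ring.
have := sqr_ge0 (u * s - v * c); lra.
Qed.

(** Cauchy-Schwarz over the frequencies against the Parseval energies; the multiplicities 1 at
    frequency 0 and 2 elsewhere undo the halves in [trig_energy] and add up to [2 d + 1]. *)
Lemma is_trig_sup d Q t V x : (2 * d < Q)%N -> is_trig d V ->
  V x ^+ 2 <= (2 * d%:R + 1) * gmean Q t (fun x => V x ^+ 2).
Proof.
move=> dQ [a [b E]].
rewrite (@eq_gmean _ _ _ _ (fun x => trig_poly d a b x ^+ 2)); last by move=> y; rewrite E.
rewrite parseval// E /trig_poly.
have -> : 2 * d%:R + 1 = \sum_(k < d.+1) (if (k : nat) == 0%N then 1 else 2) :> R.
  rewrite big_ord_recl /= (eq_bigr (fun=> 2))// sumr_const card_ord -[2 *+ d]mulr_natl; ring.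
apply: sum_sqr_le => [[[|k] ?]//=|k|[[|k] kd]/=]; first exact: trig_energy_ge0.
  by rewrite /trig_term mul0r cos0 sin0 mulr1 mulr0 addr0 mul1r.
by rewrite mulrC divfK//; exact: sqr_cos_sin.
Qed.

(** As for [is_trig_sup], with an extra weight [k^2] from differentiating frequency [k]. *)
Lemma is_trig_deriv_sup d Q t V V' x : (2 * d < Q)%N -> is_trig d V ->
  is_derive x 1 V V' ->
  V' ^+ 2 <= (\sum_(k < d.+1) 2 * (k ^ 2)%:R) * gmean Q t (fun x => V x ^+ 2).
Proof.
move=> dQ [a [b E]] dV.
rewrite (@eq_gmean _ _ _ _ (fun x => trig_poly d a b x ^+ 2)); last by move=> y; rewrite E.
rewrite parseval//.
have -> : V' = \sum_(k < d.+1) (k%:R * (b k * cos (k%:R * x) + (- a k) * sin (k%:R * x))).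
  have VE : V = trig_poly d a b by apply/funext.
  rewrite VE in dV; have [_ <-] := dV.
  have H : is_derive x 1 (trig_poly d a b) (\sum_(k < d.+1)
      (a k * (- k%:R * sin (k%:R * x)) + b k * (k%:R * cos (k%:R * x)))).
    apply: is_derive_fsum => k; apply: is_deriveD.
      exact/is_derive_scale/is_derive_cosM.
    exact/is_derive_scale/is_derive_sinM.
  have [_ ->] := H; apply: eq_bigr => k _; ring.
apply: sum_sqr_le => [k|k|[[|k] kd]/=]; first by rewrite mulr_ge0.
- exact: trig_energy_ge0.
- by rewrite mul0r expr0n /= mulr0 mul0r.
rewrite exprMn natrX -mulrA [leRHS]mulrCA ler_wpM2l ?sqr_ge0//.
by rewrite [leRHS]mulrC divfK// [leRHS]addrC -[a k.+1 ^+ 2]sqrrN; exact: sqr_cos_sin.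
Qed.

Lemma sum_sqr_bound d : \sum_(k < d.+1) 2 * (k ^ 2)%:R = d%:R * (d%:R + 1) * (2 * d%:R + 1) / 3 :> R.
Proof.
elim: d => [|d IH]; first by rewrite big_ord_recl big_ord0 /= mul0r; ring.
by rewrite big_ord_recr /= IH natrX -(natr1 d); field.
Qed.

End trig2.

(** * The variational principle *)

Section var.
Context {R : realType}.

Lemma rV_coord_le n (v : 'rV[R]_n) i : `|v ord0 i| <= `|v|.
Proof.
have /mapP[j Hj E] : `|v ord0 i| \in [seq `|v x.1 x.2| | x : 'I_1 * 'I_n].
  by apply/mapP; exists (ord0, i) => //=; rewrite mem_enum.
by rewrite E [leRHS]/Num.norm /= mx_normrE; apply/bigmax_geP; right => /=; exists j.
Qed.

Lemma lipschitz_rV_continuous n (f : 'rV[R]_n -> R) (M : R) :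
  (forall v w, f v - f w <= M * `|v - w|) -> continuous f.
Proof.
move=> H v; apply/(cvgrPdist_lt (F := nbhs v) (FF := nbhs_filter v)) => e e0.
have M1 : 0 < `|M| + 1 by rewrite ltr_wpDl.
apply/nbhs_ballP; exists (e / (`|M| + 1)); first by rewrite /= divr_gt0.
move=> w; rewrite -ball_normE /= => vw.
have le u : M * `|u : 'rV[R]_n| <= (`|M| + 1) * `|u|.
  by rewrite ler_wpM2r// (le_trans (ler_norm _))// lerDl.
apply: (@le_lt_trans _ _ ((`|M| + 1) * `|v - w|)); last by rewrite mulrC -ltr_pdivlMr.
rewrite ler_norml; apply/andP; split; last exact: le_trans (H v w) (le _).
rewrite lerNl opprB distrC; exact: le_trans (H w v) (le _).
Qed.

Definition comb K (c : 'I_K -> R -> R) (v : 'rV[R]_K) (x : R) : R := \sum_i v ord0 i * c i x.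

Section lemma.
Variables (K Q : nat) (c : 'I_K -> R -> R) (L rho r B : R) (N A z : 'I_Q -> R).
Variables (kap : 'I_K -> R) (G : 'rV[R]_K -> R).
Hypothesis c_cont : forall i, continuous (c i).
Hypothesis c_le1 : forall i x, `|c i x| <= 1.
Hypothesis L_ge0 : 0 <= L.
Hypothesis c_lip : forall i x y, `|c i x - c i y| <= L * `|x - y|.
Hypothesis r_gt0 : 0 < r.
Hypothesis N_ge0 : forall j, 0 <= N j.
Hypothesis A_gt0 : forall j, 0 < A j.
Hypothesis G_cont : continuous G.
Hypothesis G0 : G 0 <= rho.
Hypothesis G_bound : forall v, G v <= rho -> `|v| <= B.
Hypothesis conc : forall v j x y, G v <= rho -> `|x| <= r -> `|y| <= r ->
  comb c v (z j + x) + comb c v (z j + y) - 2 * comb c v (z j + (x + y) / 2)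
    <= A j / 8 * (x - y) ^+ 2.
Hypothesis pos : forall v, G v = rho -> exists2 d : 'I_Q -> R, forall j, `|d j| <= r
  & \sum_i v ord0 i * kap i <
    \sum_j N j * (comb c v (z j + d j) - A j / 2 * d j ^+ 2).

Let psi v j x := comb c v (z j + x) - A j / 2 * x ^+ 2.

Let psi_max v j : exists2 x, `|x| <= r & forall y, `|y| <= r -> psi v j y <= psi v j x.
Proof.
have [||x] := @EVT_max R (psi v j) (- r) r; first by rewrite ge0_cp// ltW.
  have ccont : continuous (fun y => comb c v (z j + y)).
    apply: continuous_big => [|i _ y]; first exact: add_continuous.
    apply: cvgM; first exact: cvg_cst.
    apply: (@continuous_comp _ _ _ (fun y => z j + y) (c i)); last exact: c_cont.
    by apply: cvgD; [exact: cvg_cst|exact: cvg_id].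
  apply: continuous_subspaceT => x; apply: cvgB; first exact: ccont.
  by apply: cvgM; [exact: cvg_cst|exact: exprn_continuous].
rewrite in_itv/= -ler_norml => xr H; exists x => // y yr; apply: H.
by rewrite in_itv/= -ler_norml.
Qed.

Lemma combD v w x : comb c (v + w) x = comb c v x + comb c w x.
Proof. by rewrite /comb -big_split; apply: eq_bigr => i _; rewrite mxE mulrDl. Qed.

Lemma combZ a v x : comb c (a *: v) x = a * comb c v x.
Proof. by rewrite /comb mulr_sumr; apply: eq_bigr => i _; rewrite mxE mulrA. Qed.

Lemma comb_le v x : `|comb c v x| <= K%:R * `|v|.
Proof.
apply: le_trans (ler_norm_sum _ _ _) _.
have -> : K%:R * `|v| = \sum_(i < K) `|v| by rewrite sumr_const card_ord mulr_natl.
apply: ler_sum => i _.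
rewrite normrM -[leRHS]mulr1 ler_pM//; exact: rV_coord_le.
Qed.

Let obj v (d : 'I_Q -> R) := \sum_j N j * psi v j (d j) - \sum_i v ord0 i * kap i.

(** For fixed [d] the function [obj] is affine in [v], and [grad w d] is its increment along [w];
    vanishing in every direction is the system to be solved. *)
Let grad v (d : 'I_Q -> R) := \sum_j N j * comb c v (z j + d j) - \sum_i v ord0 i * kap i.

Let objD v w d : obj (v + w) d = obj v d + grad w d.
Proof.
rewrite /obj /grad /psi addrACA -opprD -!big_split /=; congr (_ - _).
  by apply: eq_bigr => j _; rewrite combD; ring.
by apply: eq_bigr => i _; rewrite mxE mulrDl.
Qed.

Let M := K%:R * \sum_j N j + \sum_i `|kap i|.

Let grad_le v d : grad v d <= M * `|v|.
Proof.
rewrite /grad /M mulrDl lerD//.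
  rewrite mulrAC mulrC mulr_suml; apply: ler_sum => j _.
  by rewrite ler_wpM2l// (le_trans (ler_norm _))// comb_le.
rewrite -sumrN mulr_suml; apply: ler_sum => i _.
rewrite (le_trans (ler_norm _))// normrN normrM mulrC ler_wpM2l//.
exact: rV_coord_le.
Qed.

(** [G] stands for a squared norm with compact sublevel sets. [pos] drives the minimiser of [Phi]
    off the sphere [G = rho], and [conc] makes the maximisers vary continuously along rays from it,
    so that the first-order condition there is the moment system. *)
Lemma variational : exists d : 'I_Q -> R, forall i, \sum_j N j * c i (z j + d j) = kap i.
Proof.
have /choice[dl dlP] : forall p : 'rV[R]_K * 'I_Q, exists x, `|x| <= r /\
    forall y, `|y| <= r -> psi p.1 p.2 y <= psi p.1 p.2 x.
  by move=> [v j]; have [x xr H] := psi_max v j; exists x.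
pose dd v j := dl (v, j).
pose Phi v := obj v (dd v).
have ddr v j : `|dd v j| <= r by have [] := dlP (v, j).
have obj_le v d : (forall j, `|d j| <= r) -> obj v d <= Phi v.
  move=> dr; rewrite lerD2r; apply: ler_sum => j _; rewrite ler_wpM2l//.
  by have [_ ->] := dlP (v, j).
have Phi_lip v w : Phi v - Phi w <= M * `|v - w|.
  have -> : Phi v = obj w (dd v) + grad (v - w) (dd v) by rewrite -objD addrC subrK.
  have := obj_le w (dd v) (ddr v); have := grad_le (v - w) (dd v); lra.
have cD : compact [set v | G v <= rho]%classic.
  apply: bounded_closed_compact.
    exists B; split; first exact: num_real.
    by move=> x Bx v /= /G_bound vB; rewrite (le_trans vB)// ltW.
  have -> : [set v | G v <= rho]%classic = (G @^-1` [set x | x <= rho])%classic by [].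
  by apply: closed_comp; [move=> v _; exact: G_cont|exact: closed_le].
have [v0] := EVT_min_rV (ex_intro _ 0 G0) cD
  (continuous_subspaceT (lipschitz_rV_continuous Phi_lip)).
rewrite inE /= => Gv0 minv0.
(* At [v = 0] only the penalties remain; since [pos] makes [Phi] positive on the sphere, the
   minimiser cannot lie there. *)
have Phi0 : Phi 0 <= 0.
  rewrite /Phi /obj [X in _ - X]big1 ?subr0 => [|i _]; last by rewrite mxE mul0r.
  apply: sumr_le0 => j _.
  rewrite mulr_ge0_le0// /psi /comb big1 => [|i _]; last by rewrite mxE mul0r.
  by rewrite sub0r oppr_le0 mulr_ge0 ?sqr_ge0// divr_ge0// ltW.
have Gv0' : G v0 < rho.
  rewrite lt_neqAle Gv0 andbT; apply/eqP => /pos[d dr].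
  rewrite -subr_gt0 -/(obj v0 d) => h.
  have := obj_le v0 d dr; have := minv0 0 (mem_set G0); lra.
exists (dd v0) => i.
(* With [w = v0 + t b], [Phi v0 <= Phi w <= Phi v0 + t grad b (dd w)], and strong
   concavity gives [dd w --> dd v0] as [t --> 0+]. *)
have key b : 0 <= grad b (dd v0).
  rewrite leNgt; apply/negP => gb.
  have [t0 t00 Gt] : exists2 t0, 0 < t0 & forall t, 0 <= t <= t0 -> G (v0 + t *: b) <= rho.
    have : \forall t \near (0 : R), G (v0 + t *: b) < rho.
      have : {for 0, continuous (fun t : R => G (v0 + t *: b))}.
        apply: (@continuous_comp _ _ _ (fun t : R => v0 + t *: b) G); last exact: G_cont.
        apply: cvgD; first exact: cvg_cst.
        by apply: cvgZr_tmp; exact: cvg_id.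
      move=> /cvgr_lt/(_ rho); rewrite scale0r addr0; exact.
    move=> /nbhs_ballP[e /= e0 He]; exists (e / 2); first by rewrite divr_gt0.
    move=> t /andP[t_ge t_le]; apply/ltW/He; rewrite -ball_normE /= sub0r normrN ger0_norm//.
    by apply: le_lt_trans t_le _; rewrite gtr_pMr//; lra.
  pose Lb := \sum_i `|b ord0 i| * L.
  have Lb_lip x y : `|comb c b x - comb c b y| <= Lb * `|x - y|.
    rewrite /comb -sumrB /Lb mulr_suml; apply: le_trans (ler_norm_sum _ _ _) _.
    by apply: ler_sum => k _; rewrite -mulrBr normrM -mulrA ler_wpM2l.
  pose C := \sum_j N j * (8 * Lb ^+ 2 / A j).
  have C_ge0 j : 0 <= 8 * Lb ^+ 2 / A j.
    by apply: divr_ge0; [apply: mulr_ge0 => //; exact: sqr_ge0|exact: ltW].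
  have C0 : 0 <= C by apply: sumr_ge0 => j _; exact: mulr_ge0.
  have step t : 0 < t <= t0 -> - (t * C) <= grad b (dd v0).
    move=> /andP[t_gt t_le]; set w := v0 + t *: b.
    have Gw : G w <= rho by apply: Gt; rewrite t_le ltW.
    have psiw j x : psi w j x = psi v0 j x + t * comb c b (z j + x).
      by rewrite /psi combD combZ; ring.
    have gw : 0 <= grad b (dd w).
      have gZ d : grad (t *: b) d = t * grad b d.
        rewrite /grad mulrBr !mulr_sumr; congr (_ - _).
          by apply: eq_bigr => j _; rewrite combZ; ring.
        by apply: eq_bigr => k _; rewrite mxE mulrA.
      have := objD v0 (t *: b) (dd w); rewrite gZ -/w -/(Phi w) => E.
      have := minv0 w (mem_set Gw); have := obj_le v0 (dd w) (ddr w) => h1 h2.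
      by rewrite -(pmulr_rge0 _ t_gt); lra.
    have Dle j : comb c b (z j + dd w j) - comb c b (z j + dd v0 j) <= t * (8 * Lb ^+ 2 / A j).
      set x := dd v0 j; set y := dd w j; set D := _ - _.
      have Aj := A_gt0 j.
      (* The maximiser [x] is compared with the midpoint: there the penalty saves
         [A j / 4 * (x - y)^2], of which [conc] takes back at most half. *)
      have a1 : A j / 8 * (x - y) ^+ 2 <= psi v0 j x - psi v0 j y.
        have mid : `|(x + y) / 2| <= r.
          have := ddr v0 j; have := ddr w j; rewrite -/x -/y !ler_norml.
          by move=> /andP[? ?] /andP[? ?]; apply/andP; split; lra.
        have [_ /(_ _ mid) /=] := dlP (v0, j); rewrite -/(dd v0 j) -/x.
        have := conc j Gv0 (ddr v0 j) (ddr w j); rewrite -/x -/y /psi.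
        set T1 := comb _ _ _; set T2 := comb _ _ _; set T3 := comb _ _ _.
        move=> h1 h2.
        have e1 : ((x + y) / 2) ^+ 2 = (x ^+ 2 + y ^+ 2) / 2 - (x - y) ^+ 2 / 4 by field.
        rewrite e1 in h2; lra.
      (* Here [y] is optimal for the perturbed [w]. With [a1] and the Lipschitz bound [Lb] this
         gives [D^2 <= 8 Lb^2 / A j * t D]. *)
      have a2 : psi v0 j x - psi v0 j y <= t * D.
        have [_ /(_ _ (ddr v0 j)) /=] := dlP (w, j); rewrite -/(dd w j) -/x -/y !psiw /D.
        lra.
      have [D0|D0] := lerP D 0.
        by apply: le_trans D0 _; apply: mulr_ge0 => //; exact: ltW.
      have D2 : D ^+ 2 <= Lb ^+ 2 * (x - y) ^+ 2.
        rewrite -[leLHS]ger0_norm ?sqr_ge0// normrX -[(x - y) ^+ 2]ger0_norm ?sqr_ge0//.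
        rewrite normrX -exprMn; apply: lerXn2r; rewrite ?nnegrE//.
          by rewrite mulr_ge0// sumr_ge0// => k _; rewrite mulr_ge0.
        by rewrite [`|x - y|]distrC; apply: le_trans (Lb_lip _ _) _; rewrite opprD addrACA subrr add0r.
      rewrite mulrA ler_pdivlMr// -(ler_pM2l D0).
      have h := ler_wpM2l (sqr_ge0 Lb) (le_trans a1 a2).
      have h2 := ler_wpM2r (ltW Aj) D2.
      rewrite expr2 in h2; lra.
    have -> : grad b (dd v0) = grad b (dd w) -
        \sum_j N j * (comb c b (z j + dd w j) - comb c b (z j + dd v0 j)).
      rewrite /grad; under [X in _ = _ - X]eq_bigr do rewrite mulrBr.
      by rewrite sumrB; ring.
    have : \sum_j N j * (comb c b (z j + dd w j) - comb c b (z j + dd v0 j)) <= t * C.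
      rewrite /C mulr_sumr; apply: ler_sum => j _.
      by rewrite mulrCA ler_wpM2l.
    lra.
  pose g := - grad b (dd v0).
  have g0 : 0 < g by rewrite oppr_gt0.
  (* Small enough that [t C <= g / 2], which contradicts [step]. *)
  pose t := Num.min t0 (g / (2 * (C + 1))).
  have C1 : 0 < 2 * (C + 1) by lra.
  have tt0 : 0 < t by rewrite lt_min t00 divr_gt0.
  have tle : t <= t0 by rewrite ge_min lexx.
  have tC : t * (2 * (C + 1)) <= g by rewrite -ler_pdivlMr// ge_min lexx orbT.
  have := step t; rewrite tt0 tle => /(_ isT) h.
  by have : - g = grad b (dd v0); [rewrite /g opprK|nra].
have gradN b d : grad (- b) d = - grad b d.
  have := objD 0 0 d; have := objD b (- b) d; have := objD 0 b d.
  rewrite subrr !add0r; lra.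
(* [key] in the directions [b] and [- b] gives equality; a unit vector isolates equation [i]. *)
have kg : grad (\row_k (k == i)%:R) (dd v0) = 0.
  apply/eqP; rewrite eq_le key andbT -oppr_ge0 -gradN; exact: key.
move: kg => /eqP; rewrite /grad subr_eq0 => /eqP; rewrite [RHS](bigD1 i)//= [X in _ = _ + X]big1 ?addr0.
  rewrite mxE eqxx mul1r => <-; apply: eq_bigr => j _; congr (_ * _).
  rewrite /comb (bigD1 i)//= [X in _ = _ + X]big1 ?addr0 ?mxE ?eqxx ?mul1r// => k ki.
  by rewrite mxE (negbTE ki) mul0r.
by move=> k ki; rewrite mxE (negbTE ki) mul0r.
Qed.

End lemma.
End var.

(** * Equal-weight nodes for the uniform measure *)

Section fejer.
Context {R : realType}.
Implicit Types (n k : nat) (x t : R).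

Definition fejer_den k : R := 4 * (k.+1%:R) ^+ 2 - 1.

Lemma fejer_den_gt0 k : 0 < fejer_den k.
Proof.
have : 1 <= k.+1%:R :> R by rewrite ler1n.
by rewrite /fejer_den; nra.
Qed.

(* [fejer K] is the Fourier partial sum of order [2 K] of [pi / 2 * |sin x|]; written
   as a sum of squares it is visibly positive. *)
Definition fejer K x : R :=
  (2 * K%:R + 1)^-1 + \sum_(k < K) 4 * sin (k.+1%:R * x) ^+ 2 / fejer_den k.

(** Telescoping of [2 / (4 j^2 - 1) = 1 / (2 j - 1) - 1 / (2 j + 1)]. *)
Lemma sum_fejer_den K : \sum_(k < K) 2 / fejer_den k = 1 - (2 * K%:R + 1)^-1 :> R.
Proof.
elim: K => [|K IH]; first by rewrite big_ord0 mulr0 add0r invr1 subrr.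
rewrite big_ord_recr IH /= /fejer_den -(natr1 K).
have K0 : 0 <= K%:R :> R by [].
by field; apply/and3P; split; rewrite ?gt_eqF//; nra.
Qed.

Lemma cos_dbl x : cos (2 * x) = 1 - 2 * sin x ^+ 2 :> R.
Proof. by rewrite mulr_natl cos_mulr2n cos2sin2; ring. Qed.

Lemma fejerE K x :
  fejer K x = 1 - \sum_(k < K) 2 / fejer_den k * cos ((2 * k.+1)%:R * x).
Proof.
have := sum_fejer_den K; rewrite /fejer.
have -> : \sum_(k < K) 2 / fejer_den k * cos ((2 * k.+1)%:R * x) =
  \sum_(k < K) 2 / fejer_den k - \sum_(k < K) 4 * sin (k.+1%:R * x) ^+ 2 / fejer_den k.
  rewrite -sumrB; apply: eq_bigr => k _.
  by rewrite (natrM _ 2) -[2 * _ * x]mulrA cos_dbl; ring.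
lra.
Qed.

Lemma sum_cos_dbl n x :
  `|sin x * \sum_(k < n) cos ((2 * k.+1)%:R * x)| <= 1.
Proof.
have -> : sin x * \sum_(k < n) cos ((2 * k.+1)%:R * x) =
  (sin ((2 * n%:R + 1) * x) - sin x) / 2.
  elim: n => [|n IH]; first by rewrite big_ord0 !mulr0 add0r mul1r subrr mul0r.
  rewrite big_ord_recr mulrDr IH /= sinM_cos (natrM _ 2) -(natr1 n).
  rewrite -[x - _]opprB sinN (_ : 2 * (n%:R + 1) * x - x = (2 * n%:R + 1) * x); last by ring.
  by rewrite (_ : x + 2 * (n%:R + 1) * x = (2 * (n%:R + 1) + 1) * x); [field|ring].
have := sin_max x; have := sin_max ((2 * n%:R + 1) * x).
by rewrite !ler_norml; lra.
Qed.

Definition sig K x : R := `|sin x| + K%:R^-1.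

(** Where [|sin x| < 4 / K] the constant term suffices. Elsewhere only the first [n], about
    [2 / |sin x|], squares are kept: their weights are at least [1 / n^2], and [sum_cos_dbl] shows
    that these squares sum to at least [n / 4]. *)
Lemma fejer_ge K x : (0 < K)%N -> sig K x / 15 <= fejer K x.
Proof.
move=> K0; have K1 : 1 <= K%:R :> R by rewrite ler1n.
pose a := `|sin x|; have a0 : 0 <= a := normr_ge0 _.
have term0 k : 0 <= 4 * sin (k.+1%:R * x) ^+ 2 / fejer_den k.
  apply: divr_ge0; last exact/ltW/fejer_den_gt0.
  by apply: mulr_ge0 => //; exact: sqr_ge0.
have KV : 0 < K%:R^-1 :> R by rewrite invr_gt0; lra.
have KK : K%:R * K%:R^-1 = 1 :> R by rewrite divff// gt_eqF//; lra.
have [aK|aK] := ltrP (a * K%:R) 4.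
  have : (2 * K%:R + 1)^-1 <= fejer K x by rewrite lerDl; apply: sumr_ge0 => k _; exact: term0.
  have : 3^-1 * K%:R^-1 <= (2 * K%:R + 1)^-1 :> R.
    by rewrite -invfM lef_pV2 ?posrE; lra.
  have : a <= 4 * K%:R^-1 by rewrite ler_pdivlMr; lra.
  rewrite /sig -/a; lra.
have a_gt0 : 0 < a by nra.
have a_le1 : a <= 1 by exact: sin_max.
(* Then [2 <= n a <= 3]: the lower bound controls the cosine sum, the upper one gives [n <= K]
   because [a K >= 4]. *)
pose n := (Num.truncn (2 / a)).+1.
have /andP[nlo nhi] := truncn_itv (ltW (divr_gt0 (ltr0Sn R 1) a_gt0)).
have na : 2 <= n%:R * a by rewrite -ler_pdivrMr// ltW.
have n3 : n%:R * a <= 3.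
  move: nlo; rewrite ler_pdivlMr// /n -(natr1 (Num.truncn _)); lra.
have nK : (n <= K)%N.
  rewrite -(ler_nat R) -(ler_pM2r a_gt0); lra.
have n0 : 0 < n%:R :> R by rewrite ltr0n.
have f1 : \sum_(k < n) sin (k.+1%:R * x) ^+ 2 / n%:R ^+ 2 <= fejer K x.
  rewrite /fejer -[leLHS]add0r; apply: lerD; first by rewrite invr_ge0; lra.
  rewrite -(big_mkord xpredT (fun k => sin (k.+1%:R * x) ^+ 2 / n%:R ^+ 2)).
  rewrite -(big_mkord xpredT (fun k => 4 * sin (k.+1%:R * x) ^+ 2 / fejer_den k)).
  rewrite [leRHS](big_cat_nat (n := n))//= -[leLHS]addr0; apply: lerD; last by apply: sumr_ge0.
  rewrite !big_mkord; apply: ler_sum => k _.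
  rewrite ler_pdivrMr ?exprn_gt0// mulrAC ler_pdivlMr ?fejer_den_gt0//.
  have kn : k.+1%:R <= n%:R :> R by rewrite ler_nat.
  have k0 : 0 <= k.+1%:R :> R by [].
  rewrite [leRHS]mulrAC mulrC ler_wpM2r ?sqr_ge0// /fejer_den; nra.
apply: le_trans f1.
have S : \sum_(k < n) sin (k.+1%:R * x) ^+ 2 =
    n%:R / 2 - (\sum_(k < n) cos ((2 * k.+1)%:R * x)) / 2.
  under [in RHS]eq_bigr do rewrite (natrM _ 2) -[2 * _ * x]mulrA cos_dbl.
  by rewrite sumrB sumr_const card_ord -mulr_sumr; field.
rewrite -mulr_suml S.
have Sle : a * (\sum_(k < n) cos ((2 * k.+1)%:R * x)) <= 1.
  apply: le_trans (ler_norm _) _.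
  by rewrite normrM /a normr_id -normrM sum_cos_dbl.
set C := \sum_(k < n) _ in Sle *.
have Cn : C <= n%:R / 2 by rewrite -(ler_pM2l a_gt0); lra.
rewrite ler_pdivlMr ?exprn_gt0//.
have sg : sig K x <= 5 / 4 * a.
  rewrite /sig -/a; have : K%:R^-1 <= a / 4 by rewrite -[leLHS]mul1r ler_pdivrMr; lra.
  lra.
have : sig K x / 15 * n%:R ^+ 2 <= (5 / 4 * a) / 15 * n%:R ^+ 2.
  by rewrite ler_wpM2r ?sqr_ge0// ler_wpM2r// invr_ge0.
have : (n%:R * a) * n%:R <= 3 * n%:R by rewrite ler_wpM2r// ltW.
lra.
Qed.

(* The mean of the Chebyshev polynomial [T_n] over [[-1, 1]]. *)
Definition cheb_moment n : R := if odd n then 0 else - (n%:R ^+ 2 - 1)^-1.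

Lemma gmean_cos_cos Q t k l : (0 < k)%N -> (k + l < Q)%N ->
  gmean Q t (fun x => cos (k%:R * x) * cos (l%:R * x)) = (k == l)%:R / 2.
Proof.
move=> k0 kl.
pose T k := @trig_term R (fun=> 1) (fun=> 0) k.
have E k' l' : gmean Q t (fun x => cos (k'%:R * x) * cos (l'%:R * x)) =
    gmean Q t (fun x => T k' x * T l' x).
  by apply: eq_gmean => x; rewrite /T /trig_term !mul1r !mul0r !addr0.
have [lk|lk|lk] := ltngtP k l.
- rewrite (@eq_gmean _ _ _ _ (fun x => cos (l%:R * x) * cos (k%:R * x))).
    by rewrite E gmean_term_neq ?mul0r// addnC.
  by move=> x; rewrite mulrC.
- by rewrite E gmean_term_neq ?mul0r.
rewrite E -lk; have := @gmean_term_sqr R Q t (fun=> 1) (fun=> 0) k.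
rewrite mul2n -addnn {2}lk => /(_ kl) e.
rewrite (@eq_gmean _ _ _ _ (fun x => T k x ^+ 2)) ?e//.
by case: (k) k0 => //= k' _; rewrite expr1n expr0n addr0.
Qed.

(** [fejer K] has frequencies up to [2 K], so [3 K < Q] prevents aliasing and orthogonality extracts
    one coefficient. In the variable [cos x], the weights [fejer / Q] form a positive quadrature of
    degree [K] for the uniform measure. *)
Lemma gmean_fejer K Q n : (3 * K < Q)%N -> (n <= K)%N ->
  gmean Q 0 (fun x => fejer K x * cos (n%:R * x)) = cheb_moment n.
Proof.
move=> KQ nK.
have Q0 : (0 < Q)%N by exact: leq_ltn_trans KQ.
rewrite (@eq_gmean _ _ _ _ (fun x => cos (n%:R * x) + (- 1) * \sum_(k < K)
   (2 / fejer_den k * (cos ((2 * k.+1)%:R * x) * cos (n%:R * x))))); last first.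
  move=> x; rewrite fejerE mulrBl mul1r mulr_suml mulN1r; congr (_ - _).
  by apply: eq_bigr => k _; rewrite mulrA.
rewrite gmeanD gmeanZ gmean_sum.
have -> : gmean Q 0 (fun x => cos (n%:R * x)) = (n == 0%N)%:R.
  case: n nK => [|n] nK.
    by rewrite (@eq_gmean _ _ _ _ (fun=> 1)) ?gmean_cst// => x; rewrite mul0r cos0.
  by rewrite gmean_cos// (leq_ltn_trans nK)// (leq_ltn_trans _ KQ)// leq_pmull.
have -> : \sum_(k < K) gmean Q 0 (fun x => 2 / fejer_den k * (cos ((2 * k.+1)%:R * x) * cos (n%:R * x)))
  = \sum_(k < K) (if (2 * k.+1)%N == n then (fejer_den k)^-1 else 0).
  apply: eq_bigr => k _; rewrite gmeanZ gmean_cos_cos//; last first.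
    rewrite (leq_ltn_trans _ KQ)// (_ : 3 * K = 2 * K + K)%N ?leq_add ?leq_mul//.
    by rewrite -mulSnr.
  case: eqP => _; last by rewrite mul0r mulr0.
  by have := fejer_den_gt0 k => f0; rewrite mulr1n; field; rewrite gt_eqF.
rewrite /cheb_moment mulN1r.
case: (boolP (odd n)) => on.
  rewrite big1 => [|k _]; first by case: n on {nK}=> // n _; rewrite subr0.
  by case: eqP => // E; move: on; rewrite -E oddM.
case: n nK on => [|n] nK on.
  rewrite big1 => [|k _]; first by rewrite expr0n sub0r invrN invr1 opprK subr0.
  by [].
have [p pE] : exists p, n.+1 = (2 * p.+1)%N.
  exists n./2; rewrite -[in LHS](odd_double_half n).
  by move: on; rewrite /= negbK => ->; rewrite add1n mul2n doubleS.
have pK : (p < K)%N by rewrite (leq_trans _ nK)// pE mul2n -addnn addSn ltnS leq_addr.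
rewrite sub0r (bigD1 (Ordinal pK))//= pE eqxx big1 ?addr0.
  by rewrite /fejer_den (natrM _ 2); congr (- (_ - 1)^-1); ring.
move=> k kp; case: eqP => // /eqP; rewrite eqn_pmul2l// eqSS => /eqP E.
by case/eqP: kp; apply/val_inj.
Qed.

(** The cumulative sums are rounded, not the individual weights: the error in [N j] is then a
    difference of consecutive bounded terms, ready for summation by parts. *)
Lemma node_counts Q (m : nat) (lam : nat -> R) :
  (forall j, 0 <= lam j) -> \sum_(j < Q) lam j = 1 ->
  exists (N : nat -> nat) (e : nat -> R),
  [/\ (\sum_(j < Q) N j)%N = m, e 0%N = 0, e Q = 0,
   (forall j, 0 <= e j <= 1) & forall j, (N j)%:R = m%:R * lam j + e j - e j.+1].
Proof.
move=> lam0 lam1.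
pose F j := \sum_(i < j) lam i.
have F0 j : 0 <= m%:R * F j by rewrite mulr_ge0// sumr_ge0.
pose c j := Num.truncn (m%:R * F j).
pose e j := m%:R * F j - (c j)%:R.
have cS j : (c j <= c j.+1)%N.
  apply: le_truncn; rewrite ler_wpM2l// /F big_ord_recr lerDl; exact: lam0.
have c0 : c 0%N = 0%N by rewrite /c /F big_ord0 mulr0 truncn0.
have cQ : c Q = m by rewrite /c /F lam1 mulr1 natrK.
exists (fun j => c j.+1 - c j)%N, e; split.
- by rewrite -(big_mkord xpredT (fun j => c j.+1 - c j)%N) telescope_sumn ?c0 ?cQ ?subn0// => i j; apply: (homo_leq leqnn leq_trans).
- by rewrite /e c0 /F big_ord0 mulr0 subr0.
- by rewrite /e cQ /F lam1 mulr1 subrr.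
- move=> j; have /andP[a b] := truncn_itv (F0 j).
  by move: b; rewrite /e -(natr1 (Num.truncn _)) -/(c j) in a * => b; lra.
- move=> j; rewrite natrB// /e /F big_ord_recr /=; ring.
Qed.

(** With [y = x / 2], [sin x = 2 sin y cos y >= 2 y cos^2 y], and [cos^2 y >= 1/2] because
    [cos (2 y) >= 0]. *)
Lemma sin_ge_half x : 0 <= x -> x <= pi / 2 -> x / 2 <= sin x.
Proof.
move=> x0 xp.
have [->|xn0] := eqVneq x 0; first by rewrite mul0r sin0.
have x_gt0 : 0 < x by rewrite lt_neqAle eq_sym xn0.
have p0 := @pi_gt0 R.
set y := x / 2; have xE : x = y + y by rewrite /y -splitr.
have y0 : 0 < y by rewrite /y divr_gt0.
have cosy z : 0 <= z <= y -> 0 <= cos z by move=> /andP[z0 zy]; apply: cos_ge0_pihalf; lra.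
have cos2 : 1 / 2 <= cos y ^+ 2.
  have c2 : 0 <= cos x by apply: cos_ge0_pihalf; lra.
  by move: c2; rewrite xE -mulr2n cos_mulr2n; lra.
have siny : y * cos y <= sin y.
  have [|z] := @MVT R sin cos 0 y y0 (fun z _ => is_derive_sin z).
    by apply: continuous_subspaceT; exact: continuous_sin.
  rewrite in_itv/= => /andP[z0 zy]; rewrite sin0 !subr0 => ->.
  rewrite mulrC (ler_wpM2r (ltW y0))//; apply/ltW.
  by rewrite ltr_cos// in_itv/=; apply/andP; split; lra.
have -> : sin x = 2 * (sin y * cos y) by rewrite xE sinD; ring.
have cy := cosy y; rewrite lexx ltW// in cy.
have := ler_wpM2r (cy isT) siny; nra.
Qed.

End fejer.

(** * Summation of the inverse weights over the grid *)

Section weights.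
Context {R : realType}.
Implicit Types (n k : nat) (x t : R).

(** Comparable to [sig^2], but a sum of two squares, so that [T'^2 wgt] splits into squares of
    trigonometric polynomials. *)
Definition wgt K x : R := sin x ^+ 2 + K%:R^-1 ^+ 2.

Lemma wgt_gt0 K x : (0 < K)%N -> 0 < wgt K x.
Proof. by move=> K0; rewrite ltr_wpDl ?sqr_ge0// exprn_gt0// invr_gt0 ltr0n. Qed.

Lemma wgt_le_sig K x : wgt K x <= sig K x ^+ 2.
Proof.
rewrite /wgt /sig -[sin x ^+ 2]real_normK ?num_real//.
have : 0 <= `|sin x| * K%:R^-1 by rewrite mulr_ge0// invr_ge0.
nra.
Qed.

(** The difference of reciprocals is chosen to telescope when summed over [i]. *)
Lemma inv_wgt_le K x i : (0 < K)%N -> i%:R * (pi / (6 * K%:R)) <= `|sin x| ->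
  (wgt K x)^-1 <= 36 * K%:R ^+ 2 * (i.+1%:R^-1 - i.+2%:R^-1).
Proof.
move=> K0 sx; have K1 : 0 < K%:R :> R by rewrite ltr0n.
have i0 : 0 <= i%:R :> R by [].
have s1 : i%:R / (3 * K%:R) <= `|sin x|.
  apply: le_trans sx; rewrite ler_wpM2l//.
  have -> : (3 * K%:R)^-1 = 2 / (6 * K%:R) :> R by field; rewrite gt_eqF.
  have V0 : 0 <= (6 * K%:R)^-1 :> R by rewrite invr_ge0; lra.
  by rewrite (ler_wpM2r V0)// pi_ge2.
have W0 : 0 < (i%:R ^+ 2 + 9) / (9 * K%:R ^+ 2) :> R.
  by rewrite divr_gt0 ?mulr_gt0 ?exprn_gt0// ltr_wpDl ?sqr_ge0.
have W : (i%:R ^+ 2 + 9) / (9 * K%:R ^+ 2) <= wgt K x.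
  rewrite /wgt -[sin x ^+ 2]real_normK ?num_real//.
  have -> : (i%:R ^+ 2 + 9) / (9 * K%:R ^+ 2) = (i%:R / (3 * K%:R)) ^+ 2 + K%:R^-1 ^+ 2 :> R.
    by field; rewrite gt_eqF.
  by rewrite lerD2r lerXn2r ?nnegrE// divr_ge0// mulr_ge0// ltW.
have := W; rewrite -lef_pV2 ?posrE ?wgt_gt0// => /le_trans; apply.
rewrite invf_div.
have -> : i.+1%:R^-1 - i.+2%:R^-1 = ((i%:R + 1) * (i%:R + 2))^-1 :> R.
  rewrite -(natr1 i.+1) -(natr1 i); field.
  by apply/andP; split; rewrite gt_eqF//; lra.
rewrite ler_pdivrMr ?ltr_wpDl ?sqr_ge0// mulrAC ler_pdivlMr; last by nra.
have K2 : 0 <= K%:R ^+ 2 :> R by rewrite sqr_ge0.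
have : (i%:R + 1) * (i%:R + 2) <= 4 * (i%:R ^+ 2 + 9) :> R by nra.
move=> h; have := ler_wpM2l K2 h; lra.
Qed.

Lemma sin_ge_dist x (d : R) : 0 <= d -> d <= x -> d <= pi - x -> d / 2 <= sin x.
Proof.
move=> d0 dx dx'; have [xp|xp] := lerP x (pi / 2).
  by apply: le_trans (sin_ge_half _ xp); lra.
have -> : sin x = sin (pi - x) by rewrite sinB sinpi cospi; ring.
by apply: le_trans (sin_ge_half _ _); lra.
Qed.

(** The grid is cut into two half periods, related by [sin (x + pi) = - sin x]. In each, the
    distances to the two zeros of [sin] grow linearly from either end, and each end contributes at
    most [36 K^2]. *)
Lemma sum_inv_wgt K t : (0 < K)%N -> 0 <= t <= 2 * pi / (6 * K)%:R ->
  \sum_(j < 6 * K) (wgt K (grid (6 * K) t j))^-1 <= 144 * K%:R ^+ 2.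
Proof.
move=> K0 /andP[t0 th]; have K1 : 0 < K%:R :> R by rewrite ltr0n.
have p0 := @pi_gt0 R.
pose h : R := 2 * pi / (6 * K)%:R.
have h0 : 0 < h by rewrite divr_gt0 ?mulr_gt0// ltr0n muln_gt0.
have hE : h / 2 = pi / (6 * K%:R) by rewrite /h natrM; field; rewrite gt_eqF.
have hpi : (3 * K)%:R * h = pi by rewrite /h !natrM; field; rewrite gt_eqF.
pose g i : R := 36 * K%:R ^+ 2 * (i.+1%:R^-1 - i.+2%:R^-1).
have g0 i : 0 <= g i.
  rewrite mulr_ge0 ?mulr_ge0 ?sqr_ge0// subr_ge0 lef_pV2 ?posrE// ler_nat; exact: leqnSn.
(* The nearer endpoint decides which of the two summands is used; keeping both avoids splitting the
   sum. *)
have local x j : (j < 3 * K)%N -> j%:R * h <= x -> x <= j.+1%:R * h ->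
    (wgt K x)^-1 <= g j + g (3 * K - j.+1)%N.
  move=> jK x1 x2.
  have sx i : i%:R * h <= x -> i%:R * h <= pi - x -> (wgt K x)^-1 <= g i.
    move=> a b; apply: inv_wgt_le => //; rewrite -hE mulrA.
    apply: le_trans (ler_norm _); apply: sin_ge_dist => //.
    by rewrite mulr_ge0// ltW.
  have jj : (3 * K - j.+1)%:R * h <= pi - x by rewrite natrB// mulrBl hpi; lra.
  have [jl|jl] := leqP j (3 * K - j.+1).
    apply: (@le_trans _ _ (g j)); last by rewrite lerDl.
    apply: sx => //; apply: le_trans jj.
    by rewrite (ler_wpM2r (ltW h0))// ler_nat.
  apply: (@le_trans _ _ (g (3 * K - j.+1)%N)); last by rewrite lerDr.
  apply: sx => //; apply: le_trans x1.
  by rewrite (ler_wpM2r (ltW h0))// ler_nat ltnW.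
have sum_g n : \sum_(j < n) g j <= 36 * K%:R ^+ 2.
  have -> : \sum_(j < n) g j = 36 * K%:R ^+ 2 * (1 - n.+1%:R^-1).
    elim: n => [|n IH]; first by rewrite big_ord0 invr1 subrr mulr0.
    by rewrite big_ord_recr IH /g /=; ring.
  have : 0 <= K%:R ^+ 2 * n.+1%:R^-1 :> R by rewrite mulr_ge0 ?invr_ge0 ?sqr_ge0.
  move: (n.+1%:R^-1) (K%:R ^+ 2) => v u uv. by rewrite mulrBr mulr1 lerBlDr lerDl -mulrA mulr_ge0.
have half s : 0 <= s <= h -> \sum_(j < 3 * K) (wgt K (j%:R * h + s))^-1 <= 72 * K%:R ^+ 2.
  move=> /andP[s0 sh].
  apply: (@le_trans _ _ (\sum_(j < 3 * K) (g j + g (3 * K - j.+1)%N))).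
    apply: ler_sum => j _; apply: local => //; first by rewrite lerDl.
    by rewrite -(natr1 j) mulrDl mul1r lerD2l.
  rewrite big_split /= [X in _ + X](reindex_inj rev_ord_inj) /=.
  rewrite [X in _ + X](eq_bigr (fun j : 'I_(3 * K) => g j)); last first.
    by move=> j _; rewrite subnSK// subKn// ltnW.
  have := sum_g (3 * K)%N; lra.
have -> : (6 * K = 3 * K + 3 * K)%N by rewrite -mulnDl.
rewrite big_split_ord /=.
rewrite (eq_bigr (fun j : 'I_(3 * K) => (wgt K (j%:R * h + t))^-1)); last first.
  by move=> j _; rewrite /grid /h -mulnDl.
rewrite [X in _ + X](eq_bigr (fun j : 'I_(3 * K) => (wgt K (j%:R * h + t))^-1)); last first.
  move=> j _; rewrite /grid -mulnDl -/h natrD mulrDl hpi.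
  rewrite (_ : pi + _ + t = (j%:R * h + t) + pi); last by ring.
  by rewrite /wgt sinDpi sqrrN.
have := half t; rewrite t0 th => /(_ isT); lra.
Qed.

End weights.

(** * The weighted norm of the derivative of a cosine polynomial *)

Section cosine.
Context {R : realType}.
Implicit Types (x y t : R).

Lemma mvt_between (f f' : R -> R) x y : (forall z : R, is_derive z 1 f (f' z)) ->
  exists z, [/\ `|z - x| <= `|y - x|, `|z - y| <= `|y - x| & f y - f x = f' z * (y - x)].
Proof.
move=> df.
have cf : continuous f.
  by move=> z; apply/differentiable_continuous/derivable1_diffP; have [] := df z.
have [xy|/ltW xy] := lerP x y.
  have [z] := MVT_segment xy (fun z _ => df z) (continuous_subspaceT cf).
  rewrite in_itv/= => /andP[z1 z2] E; exists z; split=> //.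
    by rewrite !ger0_norm; lra.
  by rewrite distrC !ger0_norm; lra.
have [z] := MVT_segment xy (fun z _ => df z) (continuous_subspaceT cf).
rewrite in_itv/= => /andP[z1 z2] E; exists z; split.
- by rewrite distrC ger0_norm; lra.
- by rewrite ger0_norm; lra.
- lra.
Qed.

Lemma norm_sqrD2 (p q : R) : (`|p| + `|q|) ^+ 2 <= 2 * p ^+ 2 + 2 * q ^+ 2.
Proof.
have := sqr_ge0 (`|p| - `|q|); rewrite sqrrB sqrrD !real_normK ?num_real//; lra.
Qed.

Variables (K : nat).
Hypothesis K_gt0 : (0 < K)%N.
Let Q := (6 * K)%N.
Implicit Types v : 'rV[R]_K.

Definition cosk (i : 'I_K) x : R := cos (i.+1%:R * x).

Definition cosp' v x := \sum_i v ord0 i * (- i.+1%:R * sin (i.+1%:R * x)).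
Definition cosp'' v x := \sum_i v ord0 i * (- i.+1%:R * (i.+1%:R * cos (i.+1%:R * x))).

Lemma is_derive_cosp v x : is_derive x 1 (comb cosk v) (cosp' v x).
Proof.
apply: is_derive_fsum => i; apply: is_derive_scale; exact: is_derive_cosM.
Qed.

Lemma is_derive_cosp' v x : is_derive x 1 (cosp' v) (cosp'' v x).
Proof.
apply: is_derive_fsum => i; do 2 apply: is_derive_scale; exact: is_derive_sinM.
Qed.

Lemma is_trig_cosp' v : is_trig K (cosp' v).
Proof.
apply: is_trig_sum => i; apply: is_trigZ; apply: is_trigZ; apply: is_trig_sin.
exact: ltn_ord.
Qed.

Lemma is_derive_cosp'_sin v x :
  is_derive x 1 (fun y => cosp' v y * sin y) (cosp'' v x * sin x + cosp' v x * cos x).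
Proof.
have d1 := is_derive_cosp' v x.
apply: (is_derive_eq (is_deriveM d1 (is_derive_sin x))).
by rewrite /GRing.scale/=; ring.
Qed.

Definition wnorm v := gmean Q 0 (fun x => cosp' v x ^+ 2 * wgt K x).

Let K1 : 1 <= K%:R :> R. Proof. by rewrite ler1n. Qed.

Let dK : (2 * K < Q)%N. Proof. by rewrite /Q ltn_mul2r K_gt0. Qed.
Let dK1 : (2 * K.+1 < Q)%N.
Proof.
rewrite /Q mulnS addnC (_ : 6 * K = 2 * K + 4 * K)%N; last by rewrite -mulnDl.
by rewrite ltn_add2l (@leq_trans 4)// leq_pmulr.
Qed.

(** Both [T' sin] and [T'] have degree at most [K + 1], and [2 (K + 1) < 6 K], so their grid
    energies do not depend on the offset. *)
Lemma wnorm_split v t : gmean Q t (fun x => cosp' v x ^+ 2 * wgt K x) =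
  gmean Q 0 (fun x => (cosp' v x * sin x) ^+ 2) +
  K%:R^-1 ^+ 2 * gmean Q 0 (fun x => cosp' v x ^+ 2).
Proof.
rewrite (@eq_gmean _ _ _ _ (fun x => (cosp' v x * sin x) ^+ 2 + K%:R^-1 ^+ 2 * cosp' v x ^+ 2)).
  rewrite gmeanD gmeanZ (gmean_sqr_shift t 0 dK (is_trig_cosp' v)).
  by rewrite (gmean_sqr_shift t 0 dK1 (is_trig_Msin (is_trig_cosp' v))).
by move=> x; rewrite /wgt; ring.
Qed.

Lemma gmean_ge0 t (g : R -> R) : (forall x, 0 <= g x) -> 0 <= gmean Q t g.
Proof. by move=> g0; rewrite mulr_ge0 ?invr_ge0// sumr_ge0. Qed.

Let S v := gmean Q 0 (fun x => cosp' v x ^+ 2).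
Let SU v := gmean Q 0 (fun x => (cosp' v x * sin x) ^+ 2).

Let S_ge0 v : 0 <= S v. Proof. by apply: gmean_ge0 => x; exact: sqr_ge0. Qed.
Let SU_ge0 v : 0 <= SU v. Proof. by apply: gmean_ge0 => x; exact: sqr_ge0. Qed.

Lemma gmean_cosp'_le v : gmean Q 0 (fun x => cosp' v x ^+ 2) <= K%:R ^+ 2 * wnorm v.
Proof.
rewrite -/(S v).
have E : K%:R ^+ 2 * K%:R^-1 ^+ 2 = 1 :> R.
  by rewrite -exprMn divff ?expr1n// gt_eqF// ltr0n.
rewrite /wnorm wnorm_split -/(S v) -/(SU v) mulrDr [X in _ + X]mulrA E mul1r.
by rewrite lerDr mulr_ge0 ?sqr_ge0.
Qed.

Let S_le v : S v <= K%:R ^+ 2 * wnorm v := gmean_cosp'_le v.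

Let SU_le v : SU v <= wnorm v.
Proof.
by rewrite /wnorm wnorm_split -/(S v) -/(SU v) lerDl mulr_ge0 ?sqr_ge0.
Qed.

Lemma wnorm_ge0 v : 0 <= wnorm v.
Proof. exact: le_trans (SU_ge0 v) (SU_le v). Qed.

(** [|T'| sig] is [|T' sin| + |T' / K|], and [is_trig_sup] bounds each part by an energy present in
    [wnorm]. *)
Lemma cosp'_sup v x : (`|cosp' v x| * sig K x) ^+ 2 <= 16 * K%:R * wnorm v.
Proof.
have G0 := wnorm_ge0 v; set G := wnorm v in G0 *.
have k1 := K1; have k0 : 0 < K%:R :> R by lra.
have KG : 0 <= K%:R * G by rewrite mulr_ge0// ltW.
have GK : G <= K%:R * G by rewrite ler_peMl.
have a1 : cosp' v x ^+ 2 <= 3 * K%:R * (K%:R ^+ 2 * G).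
  apply: le_trans (is_trig_sup 0 x dK (is_trig_cosp' v)) _.
  by apply: ler_pM; [lra|exact: S_ge0|lra|exact: S_le].
have a2 : (cosp' v x * sin x) ^+ 2 <= 5 * (K%:R * G).
  apply: le_trans (is_trig_sup 0 x dK1 (is_trig_Msin (is_trig_cosp' v))) _.
  apply: (@le_trans _ _ ((2 * K.+1%:R + 1) * G)).
    by apply: ler_wpM2l; [rewrite addr_ge0// mulr_ge0|exact: SU_le].
  by rewrite -(natr1 K); lra.
have a3 : (cosp' v x / K%:R) ^+ 2 <= 3 * (K%:R * G).
  rewrite expr_div_n ler_pdivrMr ?exprn_gt0//; lra.
have -> : `|cosp' v x| * sig K x = `|cosp' v x * sin x| + `|cosp' v x / K%:R|.
  by rewrite /sig mulrDr !normrM [`|K%:R^-1|]ger0_norm// invr_ge0 ltW.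
apply: le_trans (norm_sqrD2 _ _) _; lra.
Qed.

(** [T'' sin = (T' sin)' - T' cos] trades the weight for derivatives of trigonometric polynomials;
    the [1 / K] part of [sig] is treated through [T''] directly. *)
Lemma cosp''_sup v x : (`|cosp'' v x| * sig K x) ^+ 2 <= 64 * K%:R ^+ 3 * wnorm v.
Proof.
have G0 := wnorm_ge0 v; set G := wnorm v in G0 *.
have k1 := K1; have k0 : 0 < K%:R :> R by lra.
set k : R := K%:R in k1 k0 *.
have S1 := S_le v; have S0 := S_ge0 v; have U0 := SU_ge0 v; have U1 := SU_le v.
rewrite -/k -/G in S1 U1.
pose E := k ^+ 3 * G.
have E0 : 0 <= E by rewrite mulr_ge0// exprn_ge0// ltW.
have KE : k ^+ 2 * (k * G) = E by rewrite /E; ring.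
have b1 : cosp'' v x ^+ 2 <= 2 * k ^+ 3 * S v.
  apply: le_trans (is_trig_deriv_sup 0 dK (is_trig_cosp' v) (is_derive_cosp' v x)) _.
  by rewrite ler_wpM2r// sum_sqr_bound -/k; nra.
have a1 : (cosp'' v x / k) ^+ 2 <= 2 * E.
  rewrite expr_div_n ler_pdivrMr ?exprn_gt0//; apply: le_trans b1 _.
  have : 2 * k ^+ 3 * S v <= 2 * k ^+ 3 * (k ^+ 2 * G).
    by rewrite ler_wpM2l// mulr_ge0// exprn_ge0// ltW.
  by rewrite /E; lra.
have a2 : (cosp' v x * cos x) ^+ 2 <= 3 * E.
  apply: (@le_trans _ _ (cosp' v x ^+ 2)).
    have c1 : cos x ^+ 2 <= 1 by have := cos2Dsin2 x; have := sqr_ge0 (sin x); lra.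
    by rewrite exprMn; apply: ler_piMr => //; exact: sqr_ge0.
  apply: le_trans (is_trig_sup 0 x dK (is_trig_cosp' v)) _.
  apply: (@le_trans _ _ (3 * k * (k ^+ 2 * G))); last by rewrite /E; lra.
  apply: ler_pM; rewrite -/k; [lra|exact: S0|lra|exact: S1].
have a3 : (cosp'' v x * sin x + cosp' v x * cos x) ^+ 2 <= 10 * E.
  apply: le_trans (is_trig_deriv_sup 0 dK1 (is_trig_Msin (is_trig_cosp' v)) (is_derive_cosp'_sin v x)) _.
  apply: (@le_trans _ _ (10 * k ^+ 3 * G)); last by rewrite /E; lra.
  rewrite sum_sqr_bound -(natr1 K) -/k; apply: ler_pM => //.
    by rewrite divr_ge0// !mulr_ge0//; lra.
  by nra.
have -> : `|cosp'' v x| * sig K x = `|(cosp'' v x * sin x + cosp' v x * cos x) - cosp' v x * cos x| + `|cosp'' v x / k|.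
  by rewrite addrK /sig mulrDr !normrM [`|k^-1|]ger0_norm// invr_ge0 ltW.
set p := _ + _ in a3 *; set q := cosp' v x * _ in a2 *; set s := _ / k in a1 *.
apply: (@le_trans _ _ (3 * (p ^+ 2 + q ^+ 2 + s ^+ 2))); last by rewrite -mulrA -/E; lra.
apply: (@le_trans _ _ ((`|p| + `|q| + `|s|) ^+ 2)).
  rewrite lerXn2r ?nnegrE ?addr_ge0// lerD2r; exact: ler_normB.
have -> : p ^+ 2 = `|p| ^+ 2 by rewrite real_normK ?num_real.
have -> : q ^+ 2 = `|q| ^+ 2 by rewrite real_normK ?num_real.
have -> : s ^+ 2 = `|s| ^+ 2 by rewrite real_normK ?num_real.
have := sqr_ge0 (`|p| - `|q|); have := sqr_ge0 (`|q| - `|s|); have := sqr_ge0 (`|p| - `|s|).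
lra.
Qed.

Lemma wnorm_shift v t : gmean Q t (fun x => cosp' v x ^+ 2 * wgt K x) = wnorm v.
Proof. by rewrite /wnorm !wnorm_split. Qed.

(** This controls the rounding error after summation by parts. The mean value theorem in the offset
    gives [h F'(s)]; Cauchy-Schwarz splits [F'] into [1 / wgt], summed by [sum_inv_wgt], and
    [T'^2 wgt], whose mean is [wnorm] at every offset. *)
Lemma shifted_sum_bound v (e : nat -> R) : (forall j, 0 <= e j <= 1) ->
  (\sum_(j < Q) e j * (comb cosk v (grid Q (2 * pi / Q%:R) j) - comb cosk v (grid Q 0 j))) ^+ 2
   <= 1536 * K%:R * wnorm v.
Proof.
move=> e01; have k1 := K1; set h := 2 * pi / Q%:R.
have p0 := @pi_gt0 R.
have h0 : 0 < h by rewrite divr_gt0 ?mulr_gt0// ltr0n muln_gt0.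
pose F t := \sum_(j < Q) e j * comb cosk v (grid Q t j).
pose F' t := \sum_(j < Q) e j * cosp' v (grid Q t j).
have dF t : is_derive t 1 F (F' t).
  apply: is_derive_fsum => j; apply: is_derive_scale.
  have d1 : is_derive t (1 : R) (fun s => grid Q s j) 1.
    apply: (is_derive_eq (is_deriveD (is_derive_cst (j%:R * (2 * pi / Q%:R)) t 1) (is_derive_id t 1))).
    by rewrite add0r.
  apply: (is_derive_eq (is_derive1_comp (is_derive_cosp v (grid Q t j)) d1)).
  by rewrite mulr1.
have -> : \sum_(j < Q) e j * (comb cosk v (grid Q h j) - comb cosk v (grid Q 0 j)) = F h - F 0.
  by rewrite /F -sumrB; apply: eq_bigr => j _; rewrite mulrBr.
have cF : continuous F.
  by move=> z; apply/differentiable_continuous/derivable1_diffP; have [] := dF z.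
have [s] := MVT_segment (ltW h0) (fun z _ => dF z) (continuous_subspaceT cF).
rewrite in_itv/= subr0 => /andP[s0 sh] ->; rewrite exprMn.
have F'le : F' s ^+ 2 <= 864 * K%:R ^+ 3 * wnorm v.
  have -> : 864 * K%:R ^+ 3 * wnorm v = (144 * K%:R ^+ 2) * (Q%:R * wnorm v).
    by rewrite /Q natrM; ring.
  have W j : 0 < wgt K (grid Q s j) by exact: wgt_gt0.
  apply: le_trans (sum_sqr_le (m := fun j : 'I_Q => (wgt K (grid Q s j))^-1)
     (e := fun j : 'I_Q => cosp' v (grid Q s j) ^+ 2 * wgt K (grid Q s j)) _ _ _ _) _.
  - by move=> j; rewrite invr_ge0 ltW.
  - by move=> j; rewrite mulr_ge0 ?sqr_ge0// ltW.
  - move=> j; rewrite mulrCA mulVf ?gt_eqF// mulr1 exprMn ler_piMl ?sqr_ge0//.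
    by have /andP[ea eb] := e01 j; rewrite exprn_ile1.
  apply: ler_pM.
  - by apply: sumr_ge0 => j _; rewrite invr_ge0 ltW.
  - by apply: sumr_ge0 => j _; rewrite mulr_ge0 ?sqr_ge0// ltW.
  - by apply: sum_inv_wgt => //; rewrite s0.
  - rewrite -(wnorm_shift v s) /gmean mulVKf// pnatr_eq0 /Q muln_eq0 negb_or /=.
    by rewrite -lt0n.
have hle : h ^+ 2 <= 16 / 9 / K%:R ^+ 2.
  have -> : h = (pi / 3) / K%:R by rewrite /h /Q natrM; field; rewrite gt_eqF//; lra.
  rewrite expr_div_n ler_wpM2r ?invr_ge0 ?sqr_ge0//.
  have p4 := @pihalf_lt2 R; nra.
have G0 := wnorm_ge0 v.
apply: le_trans (ler_pM (sqr_ge0 _) (sqr_ge0 _) F'le hle) _.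
rewrite le_eqVlt; apply/orP; left; apply/eqP; field.
by rewrite gt_eqF//; lra.
Qed.

End cosine.

(** * Continuity, coercivity and Taylor estimates *)

Section nodes.
Context {R : realType}.
Implicit Types (x y t : R).

Lemma le_of_sqr (x y : R) : 0 <= y -> x ^+ 2 <= y ^+ 2 -> x <= y.
Proof. by move=> y0 h; rewrite leNgt; apply/negP => xy; nra. Qed.

Lemma rV_norm_le n (v : 'rV[R]_n) (B : R) : 0 <= B -> (forall i, `|v ord0 i| <= B) -> `|v| <= B.
Proof.
move=> B0 vB; rewrite [leLHS]/Num.norm /= mx_normrE; apply/bigmax_leP; split=> // -[i j] _ /=.
by rewrite (ord1 i).
Qed.

Lemma sin_lip x y : `|sin y - sin x| <= `|y - x|.
Proof.
have [z [_ _ ->]] := @mvt_between R sin cos x y (fun z => is_derive_sin z).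
by rewrite normrM ler_piMl// cos_max.
Qed.

Lemma cos_mul_lip (n : nat) x y : `|cos (n%:R * y) - cos (n%:R * x)| <= n%:R * `|y - x|.
Proof.
have [z [_ _ ->]] := @mvt_between R _ _ x y (is_derive_cosM n%:R).
rewrite normrM ler_wpM2r// normrM normrN normr_nat ler_piMr//; exact: sin_max.
Qed.

Variable (K : nat).
Hypothesis K_gt0 : (0 < K)%N.
Let Q := (6 * K)%N.
Implicit Types v : 'rV[R]_K.

Lemma cosp'_continuous x : continuous (fun v => cosp' v x).
Proof.
pose g (i : 'I_K) : R := - i.+1%:R * sin (i.+1%:R * x).
apply: (lipschitz_rV_continuous (M := \sum_i `|g i|)) => v w.
rewrite /cosp' -sumrB mulr_suml; apply: ler_sum => i _.
rewrite -/(g i) -mulrBl mulrC; apply: le_trans (ler_norm _) _; rewrite normrM ler_wpM2l//.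
by have := rV_coord_le (v - w) i; rewrite !mxE.
Qed.

Lemma wnorm_continuous : continuous (@wnorm R K).
Proof.
have cV x : continuous (fun v => cosp' v x).
  exact: cosp'_continuous.
have cS : continuous (fun v => \sum_(j < Q) cosp' v (grid Q 0 j) ^+ 2 * wgt K (grid Q 0 j)).
  apply: continuous_big => [|j _ v]; first exact: add_continuous.
  have F := nbhs_filter v.
  apply: cvgM; last exact: cvg_cst.
  exact: (cvgM (cV _ v) (cV _ v)).
move=> v; have F := nbhs_filter v.
by apply: cvgM; [exact: cvg_cst|exact: cS].
Qed.

(** Parseval recovers the coefficients of [T'], each at least as large in modulus as the matching
    one of [v]; thus sublevel sets of [wnorm] are bounded. *)
Lemma wnorm_coord v i : v ord0 i ^+ 2 <= 2 * K%:R ^+ 2 * wnorm v.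
Proof.
have dK : (2 * K < Q)%N by rewrite /Q ltn_mul2r K_gt0.
(* Coordinate [i] of [v] belongs to frequency [i + 1], hence the predecessor; [insub] gives 0 beyond
   the range. *)
pose b k : R := if insub k.-1 is Some i then - k%:R * v ord0 i else 0.
have bE (j : 'I_K) : b j.+1 = - j.+1%:R * v ord0 j by rewrite /b /= (valK j).
have E x : cosp' v x = trig_poly K (fun=> 0) b x.
  rewrite /trig_poly big_ord_recl {1}/trig_term !mul0r sin0 mulr0 add0r add0r.
  rewrite /cosp'; apply: eq_bigr => j _; rewrite /trig_term lift0 bE; ring.
have := gmean_cosp'_le K_gt0 v.
rewrite (@eq_gmean _ _ _ _ (fun x => trig_poly K (fun=> 0) b x ^+ 2)) => [|x]; last by rewrite E.
rewrite parseval// => h.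
have iK : (i.+1 < K.+1)%N by rewrite ltnS.
rewrite -mulrA -[leLHS]mulr1 -ler_pdivrMl//; apply: le_trans h.
rewrite (bigD1 (Ordinal iK))//= -[leLHS]addr0; apply: lerD; last first.
  by apply: sumr_ge0 => k _; exact: trig_energy_ge0.
rewrite expr0n add0r bE mulrC mulr1 ler_wpM2r// exprMn sqrrN ler_peMl ?sqr_ge0//.
by rewrite exprn_ege1// ler1n.
Qed.

Lemma wnorm_bounded (rho : R) v : wnorm v <= rho -> `|v| <= 1 + 2 * K%:R ^+ 2 * rho.
Proof.
move=> vr; have G0 := wnorm_ge0 K_gt0 v.
have K2 : 0 <= 2 * K%:R ^+ 2 :> R by rewrite mulr_ge0 ?sqr_ge0.
have le : 2 * K%:R ^+ 2 * wnorm v <= 2 * K%:R ^+ 2 * rho by rewrite ler_wpM2l.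
have h0 : 0 <= 2 * K%:R ^+ 2 * wnorm v by rewrite mulr_ge0.
apply: rV_norm_le; first lra.
move=> i; have := wnorm_coord v i; rewrite -[_ ^+ 2]real_normK ?num_real//.
nra.
Qed.

(** Two mean value steps, which cost the factor 1/2 of Taylor's formula. *)
Lemma cosp_taylor v x d B : (forall u, `|u - x| <= `|d| -> `|cosp'' v u| <= B) ->
  `|comb (@cosk R K) v (x + d) - comb (@cosk R K) v x - cosp' v x * d| <= B * d ^+ 2.
Proof.
move=> vB.
have [z [zx _ ->]] := mvt_between x (x + d) (is_derive_cosp v).
have [u [ux _ E]] := mvt_between x z (is_derive_cosp' v).
rewrite addrAC subrr add0r in zx *.
rewrite -mulrBl E !normrM -[d ^+ 2]real_normK ?num_real// expr2 mulrA.
rewrite ler_wpM2r// ler_pM//; apply: vB; exact: le_trans ux zx.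
Qed.

End nodes.

(** * Integer multiplicities and angles with the right cosine moments *)

Section assembly.
Context {R : realType}.

Lemma cosine_nodes (K m : nat) : (0 < K)%N -> ((700 * K) ^ 2 <= m)%N ->
  exists (N : 'I_(6 * K) -> nat) (phi : 'I_(6 * K) -> R),
    (\sum_j N j)%N = m /\
    forall i : 'I_K, \sum_j (N j)%:R * cos (i.+1%:R * phi j) = m%:R * cheb_moment i.+1.
Proof.
move=> K0 mK.
pose k : R := K%:R; pose M : R := m%:R.
have k1 : 1 <= k by rewrite /k ler1n.
have k0 : 0 < k by lra.
have Mk : (700 * k) ^+ 2 <= M by rewrite /k /M -natrM -natrX ler_nat.
pose Q := (6 * K)%N.
have QE : Q%:R = 6 * k :> R by rewrite /Q natrM.
have Q0 : (0 < Q)%N by rewrite muln_gt0.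
have Qr0 : 0 < Q%:R :> R by rewrite ltr0n.
have QK : (3 * K < Q)%N by rewrite /Q ltn_mul2r K0.
pose th (j : nat) : R := grid Q 0 j.
pose lam j : R := Q%:R^-1 * fejer K (th j).
have sig_ge x : k^-1 <= sig K x by rewrite /sig lerDr.
have kV0 : 0 < k^-1 by rewrite invr_gt0.
have sig0 (x : R) : 0 < sig K x by exact: lt_le_trans kV0 (sig_ge x).
have lam_ge j : sig K (th j) / (90 * k) <= lam j.
  have := fejer_ge (th j) K0; rewrite /lam QE => h.
  have -> : sig K (th j) / (90 * k) = (6 * k)^-1 * (sig K (th j) / 15) by field; rewrite gt_eqF.
  by rewrite ler_wpM2l// invr_ge0; lra.
have lam0 j : 0 <= lam j.
  apply: le_trans (lam_ge j); rewrite divr_ge0 ?ltW//; lra.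
have lam1 : \sum_(j < Q) lam j = 1.
  have := @gmean_fejer R K Q 0 QK isT; rewrite /cheb_moment /= expr0n sub0r invrN invr1 opprK => <-.
  rewrite /gmean mulr_sumr; apply: eq_bigr => j _.
  by rewrite mul0r cos0 mulr1.
have [N [e [Nm e0 eQ e01 NE]]] := @node_counts R Q m lam lam0 lam1.
(* [M lam j] is at least twice this bound and the bound is at least 1, so rounding, which loses at
   most 1, leaves half. *)
have N_ge (j : nat) : M * sig K (th j) / (180 * k) <= (N j)%:R.
  have := e01 j; have := e01 j.+1 => /andP[a1 a2] /andP[b1 b2].
  have h1 : 1 <= M * sig K (th j) / (180 * k).
    rewrite ler_pdivlMr ?mulr_gt0// mul1r.
    have : M * k^-1 <= M * sig K (th j) by rewrite ler_wpM2l.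
    apply: le_trans; rewrite ler_pdivlMr//; nra.
  have h2 : 2 * (M * sig K (th j) / (180 * k)) <= M * lam j.
    have -> : 2 * (M * sig K (th j) / (180 * k)) = M * (sig K (th j) / (90 * k)).
      by field; rewrite gt_eqF.
    by rewrite ler_wpM2l.
  by rewrite NE -/M; lra.
have W0 (x : R) : 0 < wgt K x by exact: wgt_gt0.
have M0 : 0 < M by nra.
have N0 (j : nat) : 0 < (N j)%:R :> R.
  by apply: lt_le_trans (N_ge j); rewrite divr_gt0 ?mulr_gt0.
(* Chosen so that the gains [N j * T'(th j)^2 / A j] sum exactly to [wnorm v]. *)
pose A (j : 'I_Q) : R := (N j)%:R * Q%:R / wgt K (th j).
have A0 j : 0 < A j by rewrite divr_gt0 ?mulr_gt0.
have A_ge j : M / 30 <= A j * sig K (th j).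
  have s0 := sig0 (th j).
  have h1 : M / 30 * (sig K (th j)) <= (N j)%:R * Q%:R.
    have := N_ge j; rewrite ler_pdivrMr ?mulr_gt0// QE; lra.
  rewrite /A mulrAC ler_pdivlMr//.
  apply: (@le_trans _ _ (M / 30 * sig K (th j) ^+ 2)).
    by rewrite ler_wpM2l ?wgt_le_sig// ltW// divr_gt0.
  by rewrite expr2 mulrA ler_wpM2r// ltW.
(* On the sphere [wnorm v = rho] the gain is at least [5 / 16 * rho = 8000 k] while the
   rounding error is at most [sqrt (1536 * k * rho) <= 6271 k]. *)
pose rho : R := 160 * 160 * k.
have Vbd (v : 'rV[R]_K) x : wnorm v <= rho -> `|cosp' v x| * sig K x <= 4 * 160 * k.
  move=> vr; apply: le_of_sqr; first lra.
  apply: le_trans (cosp'_sup K0 v x) _; rewrite -/k.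
  have : 16 * k * wnorm v <= 16 * k * rho by rewrite ler_wpM2l//; lra.
  by rewrite /rho; lra.
have Wbd (v : 'rV[R]_K) x : wnorm v <= rho -> `|cosp'' v x| * sig K x <= 8 * 160 * k ^+ 2.
  move=> vr; apply: le_of_sqr; first by have := sqr_ge0 k; lra.
  apply: le_trans (cosp''_sup K0 v x) _; rewrite -/k.
  have : 64 * k ^+ 3 * wnorm v <= 64 * k ^+ 3 * rho.
    by rewrite ler_wpM2l// mulr_ge0// exprn_ge0// ltW.
  by rewrite /rho; lra.
(* Within [2 / K] of [th j], [sig] varies by a factor at most 3. The constant 700 is dictated here:
   [3 * 1280 k^2 <= M / 120] requires [M >= 460800 k^2]. *)
have curv (v : 'rV[R]_K) (j : 'I_Q) u : wnorm v <= rho -> `|u - th j| <= 2 * k^-1 ->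
    `|cosp'' v u| <= A j / 4.
  move=> vr uj.
  have s3 : sig K (th j) <= 3 * sig K u.
    have := sig_ge u; have := sin_lip (th j) u => h; rewrite /sig -/k.
    have : `|sin (th j)| <= `|sin u| + `|sin u - sin (th j)|.
      by rewrite -[X in `|X| <= _](subKr (sin u)) (le_trans (ler_normB _ _)).
    have := normr_ge0 (sin u); lra.
  rewrite -(ler_pM2r (sig0 (th j))).
  apply: (@le_trans _ _ (`|cosp'' v u| * (3 * sig K u))); first by rewrite ler_wpM2l.
  have := Wbd v u vr; have := A_ge j; nra.
have slope (v : 'rV[R]_K) (j : 'I_Q) : wnorm v <= rho ->
    `|cosp' v (th j) / (2 * A j)| <= k^-1.
  move=> vr; have A2 : 0 < 2 * A j by rewrite mulr_gt0.
  rewrite normrM normfV (gtr0_norm A2) ler_pdivrMr// -(ler_pM2r (sig0 (th j))).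
  apply: le_trans (Vbd v (th j) vr) _.
  have h : M / 30 * k^-1 <= A j * sig K (th j) * k^-1 by rewrite ler_wpM2r// ltW.
  have h2 : 4 * 160 * k <= 2 * (M / 30 * k^-1).
    rewrite (_ : 2 * _ = M / 15 / k); last by field; rewrite gt_eqF.
    by rewrite ler_pdivlMr//; nra.
  lra.
have rho0 : 0 <= rho by rewrite /rho; lra.
have w0 : wnorm (0 : 'rV[R]_K) <= rho.
  rewrite /wnorm (@eq_gmean _ _ _ _ (fun=> 0)) ?gmean_cst// => x.
  rewrite /cosp' big1 => [|i _]; last by rewrite mxE mul0r.
  by rewrite expr0n mul0r.
have ccont (i : 'I_K) : continuous (@cosk R K i).
  move=> x; apply/differentiable_continuous/derivable1_diffP.
  by have [] := is_derive_cosM i.+1%:R x.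
have clip (i : 'I_K) x y : `|@cosk R K i x - @cosk R K i y| <= k * `|x - y|.
  rewrite /cosk; apply: le_trans (cos_mul_lip _ _ _) _.
  by rewrite ler_wpM2r// /k ler_nat.
have conc (v : 'rV[R]_K) (j : 'I_Q) x y : wnorm v <= rho -> `|x| <= k^-1 -> `|y| <= k^-1 ->
    comb (@cosk R K) v (th j + x) + comb (@cosk R K) v (th j + y) -
      2 * comb (@cosk R K) v (th j + (x + y) / 2) <= A j / 8 * (x - y) ^+ 2.
  move=> vr; rewrite !ler_norml => /andP[x1 x2] /andP[y1 y2].
  (* Expanding at the midpoint cancels the linear terms; the two errors are at most [A j / 4 * q^2]
     each. *)
  pose p := th j + (x + y) / 2; pose q := (x - y) / 2.
  have near u : `|u - p| <= `|q| -> `|cosp'' v u| <= A j / 4.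
    move=> up; apply: curv => //.
    have : `|u - th j| <= `|u - p| + `|(x + y) / 2|.
      by rewrite (_ : u - th j = (u - p) + (x + y) / 2) ?ler_normD// /p; ring.
    have : `|q| <= k^-1 by rewrite ler_norml /q; apply/andP; split; lra.
    have : `|(x + y) / 2| <= k^-1 by rewrite ler_norml; apply/andP; split; lra.
    lra.
  have t1 := cosp_taylor near.
  have t2 : `|comb (@cosk R K) v (p + - q) - comb (@cosk R K) v p - cosp' v p * - q| <= A j / 4 * (- q) ^+ 2.
    by apply: cosp_taylor => u; rewrite normrN; exact: near.
  have -> : th j + x = p + q by rewrite /p /q; field.
  have -> : th j + y = p + - q by rewrite /p /q; field.
  have -> : A j / 8 * (x - y) ^+ 2 = 2 * (A j / 4 * q ^+ 2) by rewrite /q; field.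
  move: t1 t2; rewrite sqrrN -/p !ler_norml => /andP[_ t1] /andP[_ t2].
  lra.
have pos (v : 'rV[R]_K) : wnorm v = rho -> exists2 d : 'I_Q -> R, forall j, `|d j| <= k^-1
  & \sum_i v ord0 i * (M * cheb_moment i.+1) <
    \sum_(j < Q) (N j)%:R * (comb (@cosk R K) v (th j + d j) - A j / 2 * d j ^+ 2).
  move=> vr; have vr' : wnorm v <= rho by rewrite vr.
  (* Half the maximiser of [T' d - A d^2 / 2]. In units of [A q^2] the gain is
     [2 - 1/4 - 1/2 = 5/4]: linear term, Taylor error, penalty. This is 5/16 of [T'^2 / A]. *)
  exists (fun j : 'I_Q => cosp' v (th j) / (2 * A j)); first by move=> j; exact: slope.
  pose T x := comb (@cosk R K) v x.
  have gain (j : 'I_Q) : (N j)%:R * T (th j) + 5 / 16 * (Q%:R^-1 * (cosp' v (th j) ^+ 2 * wgt K (th j))) <=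
      (N j)%:R * (comb (@cosk R K) v (th j + cosp' v (th j) / (2 * A j)) - A j / 2 * (cosp' v (th j) / (2 * A j)) ^+ 2).
    set q := cosp' v (th j) / (2 * A j).
    have near u : `|u - th j| <= `|q| -> `|cosp'' v u| <= A j / 4.
      by move=> uq; apply: curv => //; apply: le_trans uq _; have := slope v j vr'; rewrite -/q; lra.
    have := cosp_taylor near; rewrite ler_norml -/(T (th j)) -/(T _) => /andP[t1 _].
    have Vq : cosp' v (th j) = 2 * A j * q by rewrite /q; field; rewrite gt_eqF.
    have -> : Q%:R^-1 * (cosp' v (th j) ^+ 2 * wgt K (th j)) = (N j)%:R * (4 * A j * q ^+ 2).
      rewrite Vq /A; move: (W0 (th j)) (N0 j) Qr0 => a b c.
      by field; rewrite !gt_eqF.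
    rewrite mulrCA -mulrDr ler_wpM2l//; rewrite Vq in t1.
    lra.
  apply: lt_le_trans (ler_sum _ (fun j _ => gain j)).
  rewrite big_split /= -!mulr_sumr -/(gmean Q 0 (fun x => cosp' v x ^+ 2 * wgt K x)) -/(wnorm v) vr.
  have -> : \sum_i v ord0 i * (M * cheb_moment i.+1) = \sum_(j < Q) M * lam j * T (th j).
    transitivity (M * gmean Q 0 (fun x => fejer K x * T x)); last first.
      rewrite /gmean mulrA mulr_sumr; apply: eq_bigr => j _; rewrite /lam /th; ring.
    rewrite (@eq_gmean _ _ _ _ (fun x => \sum_i v ord0 i * (fejer K x * cos (i.+1%:R * x)))); last first.
      by move=> x; rewrite /T /comb mulr_sumr; apply: eq_bigr => i _; rewrite /cosk; ring.
    rewrite gmean_sum mulr_sumr; apply: eq_bigr => i _.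
    by rewrite gmeanZ gmean_fejer//; ring.
  (* Summation by parts; the boundary terms vanish because [e 0 = e Q = 0], and the grid with offset
     [2 pi / Q] is the grid moved by one index. *)
  have -> : \sum_(j < Q) (N j)%:R * T (th j) = \sum_(j < Q) M * lam j * T (th j) +
      \sum_(j < Q) e j.+1 * (T (grid Q (2 * pi / Q%:R) j) - T (th j)).
    have tel : \sum_(j < Q) (e j.+1 * T (th j.+1) - e j * T (th j)) = 0.
      rewrite -(big_mkord xpredT (fun j => e j.+1 * T (th j.+1) - e j * T (th j))).
      by rewrite (telescope_sumr (fun j => e j * T (th j)))// e0 eQ !mul0r subrr.
    transitivity (\sum_(j < Q) (N j)%:R * T (th j) +
      \sum_(j < Q) (e j.+1 * T (th j.+1) - e j * T (th j))); first by rewrite tel addr0.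
    rewrite -!big_split /=; apply: eq_bigr => j _.
    have -> : grid Q (2 * pi / Q%:R) j = th j.+1 by rewrite /th /grid -(natr1 j); ring.
    by rewrite NE; ring.
  set X := \sum_(j < Q) e j.+1 * _.
  have X2 : X ^+ 2 <= (6271 * k) ^+ 2.
    have e01' (j : nat) : 0 <= e j.+1 <= 1 by exact: e01.
    apply: le_trans (shifted_sum_bound K0 v e01') _; rewrite vr -/k /rho.
    have := sqr_ge0 k; lra.
  have : - X <= 6271 * k by apply: le_of_sqr; [lra|rewrite sqrrN].
  by rewrite /rho; lra.
have [d dE] := variational ccont (fun i x => cos_max _) (ltW k0) clip kV0 (fun j : 'I_Q => ltW (N0 j)) A0
  (wnorm_continuous (K := K)) w0 (fun v vr => wnorm_bounded K0 vr) conc pos.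
exists (fun j : 'I_Q => N j), (fun j : 'I_Q => th j + d j); by split.
Qed.

End assembly.

(** * From cosine moments to polynomials on the interval *)

Section polynomial.
Context {R : realType}.
Implicit Types (x y t : R) (d n : nat).

Definition is_cosp d (f : R -> R) :=
  exists a : nat -> R, forall x, f x = \sum_(n < d.+1) a n * cos (n%:R * x).

Lemma is_cosp_widen d n f : (n <= d)%N -> is_cosp n f -> is_cosp d f.
Proof.
move=> nd [a E]; exists (fun k => if (k < n.+1)%N then a k else 0) => x.
rewrite E (big_ord_widen d.+1 (fun k => a k * cos (k%:R * x)))// big_mkcond.
by apply: eq_bigr => k _; case: ifP => //; rewrite mul0r.
Qed.

Lemma is_cosp_sum d (I : finType) (F : I -> R -> R) :
  (forall i, is_cosp d (F i)) -> is_cosp d (fun x => \sum_i F i x).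
Proof.
move=> /choice[a aE]; exists (fun k => \sum_i a i k) => x.
under eq_bigr do rewrite aE.
by rewrite exchange_big; apply: eq_bigr => k _; rewrite mulr_suml.
Qed.

Lemma is_cospZ d c f : is_cosp d f -> is_cosp d (fun x => c * f x).
Proof.
move=> [a aE]; exists (fun k => c * a k) => x; rewrite aE mulr_sumr.
by apply: eq_bigr => k _; rewrite mulrA.
Qed.

Lemma is_cosp_Mcos d f : is_cosp d f -> is_cosp d.+1 (fun x => f x * cos x).
Proof.
move=> [a aE].
(* Frequency [k] receives halves from its two neighbours, except that frequency 0 passes wholly to
   frequency 1. *)
exists (fun k => (if (0 < k)%N then (if k == 1%N then a 0%N else a k.-1 / 2) else 0) +
  (if (k < d)%N then a k.+1 / 2 else 0)) => x.
rewrite aE mulr_suml.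
under [RHS]eq_bigr do rewrite mulrDl.
rewrite big_split /= [X in _ = X + _]big_ord_recl /= mul0r add0r.
have -> : \sum_(k < d.+2) (if (k < d)%N then a k.+1 / 2 else 0) * cos (k%:R * x) =
    \sum_(k < d) a k.+1 / 2 * cos (k%:R * x).
  rewrite (big_ord_widen d.+2 (fun k => a k.+1 / 2 * cos (k%:R * x))) 1?ltnW// [RHS]big_mkcond.
  by apply: eq_bigr => k _; case: ifP => //; rewrite mul0r.
rewrite [LHS]big_ord_recl [X in _ = X + _]big_ord_recl /= mul0r cos0 mul1r mulr1 -addrA.
congr (_ + _); rewrite -big_split /=; apply: eq_bigr => k _; rewrite /bump leq0n add1n /=.
rewrite -(natr1 k.+1) -(natr1 k).
have -> : (k%:R + 1 + 1) * x = (k%:R + 1) * x + x by ring.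
have -> : k%:R * x = (k%:R + 1) * x - x by ring.
by set y := (_ + 1) * x; rewrite (cosD y x) (cosB y x); field.
Qed.

Lemma is_cosp_horner d (p : {poly R}) : (size p <= d.+1)%N -> is_cosp d (fun x => p.[cos x]).
Proof.
move=> sp.
have cosX n : (n <= d)%N -> is_cosp d (fun x => cos x ^+ n).
  move=> nd; apply: is_cosp_widen nd _; elim: n => [|n [a E]].
    by exists (fun=> 1) => x; rewrite big_ord_recl big_ord0 mul0r cos0 mulr1 addr0.
  have [b bE] := is_cosp_Mcos (ex_intro _ a E).
  by exists b => x; rewrite -bE exprSr.
have [a aE] : is_cosp d (fun x => \sum_(i < d.+1) p`_i * cos x ^+ i).
  by apply: is_cosp_sum => i; apply: is_cospZ; apply: cosX; rewrite -ltnS.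
by exists a => x; rewrite -aE (horner_coef_wide _ sp).
Qed.

Lemma cos_natM_pi n : cos (n%:R * pi) = (-1) ^+ n :> R.
Proof.
elim: n => [|n IH]; first by rewrite mul0r cos0.
by rewrite -(natr1 n) mulrDl mul1r cosDpi IH exprS mulN1r.
Qed.

(** The substitution [t = cos x]: [P(cos x)] and the explicit antiderivatives of
    [- a_n cos (n x) sin x] differ by a constant, and are compared at 0 and [pi]. *)
Lemma horner_cos_moments d (P : {poly R}) (a : nat -> R) :
  (forall x, P^`().[cos x] = \sum_(n < d.+1) a n * cos (n%:R * x)) ->
  P.[1] - P.[-1] = \sum_(n < d.+1) a n * (2 * cheb_moment n).
Proof.
move=> PE.
(* At [n = 1] the second coefficient is the inverse of 0, hence 0, and the derivative formula
   survives because [sin 0 = 0]. *)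
pose F n x : R := (2 * (n%:R + 1))^-1 * cos ((n%:R + 1) * x) - (2 * (n%:R - 1))^-1 * cos ((n%:R - 1) * x).
have dF n x : is_derive x 1 (F n) (- (cos (n%:R * x) * sin x)).
  have h := is_deriveB (is_derive_scale (2 * (n%:R + 1))^-1 (is_derive_cosM (n%:R + 1) x))
    (is_derive_scale (2 * (n%:R - 1))^-1 (is_derive_cosM (n%:R - 1) x)).
  apply: (is_derive_eq h).
  have n1 : n%:R + 1 != 0 :> R by rewrite natr1 pnatr_eq0.
  have e1 : (2 * (n%:R + 1))^-1 * (- (n%:R + 1) * sin ((n%:R + 1) * x)) = - sin ((n%:R + 1) * x) / 2.
    by field.
  have e2 : (2 * (n%:R - 1))^-1 * (- (n%:R - 1) * sin ((n%:R - 1) * x)) = - sin ((n%:R - 1) * x) / 2.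
    have [->|n2] := eqVneq (n%:R - 1 : R) 0; first by rewrite mul0r sin0 !mulr0 oppr0 mul0r.
    by field.
  by rewrite e1 e2 mulrDl mulrBl mul1r sinD sinB; field.
pose g x := P.[cos x] - \sum_(n < d.+1) a n * F n x.
have dg x : is_derive x (1 : R) g 0.
  have h1 := is_derive1_comp (is_derive_poly P (cos x)) (is_derive_cos x).
  have h2 : is_derive x (1 : R) (fun y => \sum_(n < d.+1) a n * F n y)
      (\sum_(n < d.+1) a n * (- (cos (n%:R * x) * sin x))).
    by apply: is_derive_fsum => n; apply: is_derive_scale.
  apply: (is_derive_eq (is_deriveB h1 h2)).
  rewrite PE mulr_suml -sumrB big1// => n _; ring.
have := is_derive_0_is_cst 0 pi dg; rewrite /g cos0 cospi => E.
have -> : P.[1] - P.[-1] = \sum_(n < d.+1) a n * F n 0 - \sum_(n < d.+1) a n * F n pi.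
  by lra.
rewrite -sumrB; apply: eq_bigr => n _; rewrite -mulrBr; congr (_ * _).
have e1 : (n%:R + 1) * pi = n%:R * pi + pi :> R by ring.
have e2 : (n%:R - 1) * pi = - (pi - n%:R * pi) :> R by ring.
rewrite /F !mulr0 cos0 e1 e2 cosDpi cosN cosB cospi sinpi mul0r addr0 mulN1r cos_natM_pi /cheb_moment -signr_odd.
case: (boolP (odd n)) => on; rewrite ?expr1 ?expr0; first by ring.
have n1 : n%:R + 1 != 0 :> R by rewrite natr1 pnatr_eq0.
have n2 : n%:R - 1 != 0 :> R.
  by rewrite subr_eq0 (eqr_nat R n 1); apply: contra on => /eqP ->.
field; rewrite n1 n2 /=.
by rewrite (_ : n%:R ^+ 2 - 1 = (n%:R - 1) * (n%:R + 1)) ?mulf_neq0//; ring.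
Qed.

Lemma uniform_nodes (K m : nat) : (0 < K)%N -> ((700 * K) ^ 2 <= m)%N ->
  exists y : 'I_m -> R, forall P : {poly R}, (size P <= K.+2)%N ->
    m%:R^-1 * \sum_i P^`().[y i] = (P.[1] - P.[-1]) / 2.
Proof.
move=> K0 mK; have [N [phi [Nm H]]] := @cosine_nodes R K m K0 mK.
(* Multiplicities become repetitions in a list of length [m], indexed to give the nodes. *)
pose s := flatten [seq nseq (N j) (cos (phi j)) | j <- enum 'I_(6 * K)].
have sums (g : R -> R) : \sum_(x <- s) g x = \sum_j (N j)%:R * g (cos (phi j)).
  rewrite /s big_flatten big_map big_enum /=; apply: eq_bigr => j _.
  by rewrite big_nseq -Monoid.iteropE /= mulr_natl.
have ss : size s = m.
  rewrite /s size_flatten /shape -map_comp -Nm sumnE big_map big_enum /=.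
  by apply: eq_bigr => j _; rewrite size_nseq.
have m0 : m%:R != 0 :> R.
  by rewrite pnatr_eq0 -lt0n (leq_trans _ mK)// expn_gt0 muln_gt0 K0.
exists (fun i => nth 0 s i) => P sP.
have -> : \sum_(i < m) P^`().[nth 0 s i] = \sum_(x <- s) P^`().[x].
  by rewrite (big_nth 0) ss big_mkord.
rewrite sums.
have sP' : (size P^`() <= K.+1)%N.
  have [->|P0] := eqVneq P 0; first by rewrite deriv0 size_poly0.
  by rewrite -ltnS (leq_trans (lt_size_deriv P0)).
have [a aE] := is_cosp_horner sP'.
rewrite (horner_cos_moments aE).
under eq_bigr do rewrite aE mulr_sumr.
rewrite exchange_big /= mulr_sumr mulr_suml; apply: eq_bigr => n _.
have -> : \sum_j (N j)%:R * (a n * cos (n%:R * phi j)) = a n * (m%:R * cheb_moment n).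
  under eq_bigr do rewrite mulrCA.
  rewrite -mulr_sumr; congr (_ * _).
  case: n => -[|n] nK /=; last exact: (H (Ordinal (nK : (n < K)%N))).
  under eq_bigr do rewrite mul0r cos0 mulr1.
  by rewrite -natr_sum Nm /cheb_moment /= expr0n sub0r invrN invr1 opprK mulr1.
by field.
Qed.

End polynomial.

(** * Even numbers of nodes *)

Section even.
Context {R : realType}.

(** The map [y -> (3 + y) / 4] carries [[-1, 1]] onto [[1/2, 1]]. Reflected nodes double the rule,
    and [B] gathers the contributions of both intervals into one polynomial on [[-1, 1]]. *)
Lemma quadrature_symmetric (k m : nat) (y : 'I_m -> R) : (0 < m)%N ->
  (forall P : {poly R}, (size P <= k.+2)%N ->
    m%:R^-1 * \sum_i P^`().[y i] = (P.[1] - P.[-1]) / 2) ->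
  has_chebyshev_quadrature (@sigma0 R) k (m + m).
Proof.
move=> m0 H.
exists (fun i => match fintype.split i with inl j => (3 + y j) / 4 | inr j => - ((3 + y j) / 4) end).
apply/chebyshev_sigma0P => P sP.
rewrite big_split_ord /=.
rewrite (eq_bigr (fun j => P^`().[(3 + y j) / 4])); last first.
  by move=> j _; rewrite (unsplitK (inl j)).
rewrite [X in _ + X](eq_bigr (fun j => P^`().[- ((3 + y j) / 4)])); last first.
  by move=> j _; rewrite (unsplitK (inr j)).
rewrite -big_split /=.
pose u : {poly R} := (1 / 4) *: 'X + (3 / 4)%:P.
pose B : {poly R} := (P \Po u) - (P \Po (- u)).
have su : (size u <= 2)%N.
  rewrite /u (leq_trans (size_polyD _ _))// geq_max (leq_trans (size_scale_leq _ _)) ?size_polyX//.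
  by rewrite (leq_trans (size_polyC_leq1 _)).
have sc (q : {poly R}) : (size q <= 2)%N -> (size (P \Po q) <= k.+2)%N.
  move=> sq; rewrite (leq_trans (size_comp_poly_leq _ _))// ltnS.
  rewrite -[leqRHS]muln1 leq_mul//; first by move: sP; case: (size P).
  by move: sq; case: (size q).
have sB : (size B <= k.+2)%N.
  rewrite /B; have := size_polyD (P \Po u) (- (P \Po (- u))); move=> /leq_trans; apply.
  by rewrite geq_max size_polyN !sc ?size_polyN.
have uE x : u.[x] = (3 + x) / 4 by rewrite /u !hornerE /=; field.
have BE x : B.[x] = P.[(3 + x) / 4] - P.[- ((3 + x) / 4)].
  by rewrite /B hornerD hornerN !horner_comp hornerN !uE.
have dB x : P^`().[(3 + x) / 4] + P^`().[- ((3 + x) / 4)] = 4 * B^`().[x].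
  rewrite /B derivB !deriv_comp derivN /u derivD derivZ derivX derivC addr0.
  by rewrite -/u !hornerE !horner_comp hornerN uE /=; field.
under eq_bigr do rewrite dB.
rewrite -mulr_sumr.
have mr : m%:R != 0 :> R by rewrite pnatr_eq0 -lt0n.
have -> : \sum_i B^`().[y i] = m%:R * ((B.[1] - B.[-1]) / 2) by rewrite -(H B sB) mulVKf.
rewrite !BE /sigma0_prim natrD.
have -> : (3 + 1) / 4 = 1 :> R by field.
have -> : (3 + -1) / 4 = 2^-1 :> R by field.
by field; rewrite -natrD pnatr_eq0 addnn double_eq0 -lt0n.
Qed.

Lemma even_quadrature (K m : nat) : (0 < K)%N -> ((700 * K) ^ 2 <= m)%N ->
  has_chebyshev_quadrature (@sigma0 R) K (m + m).
Proof.
move=> K0 mK; have [y yP] := @uniform_nodes R K m K0 mK.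
by apply: (quadrature_symmetric (y := y)) => //; rewrite (leq_trans _ mK)// expn_gt0 muln_gt0 K0.
Qed.

(** Nodes at [3/4] and [-3/4]; this serves the even [n] too small for [even_quadrature], where a
    positive degree is still demanded. *)
Lemma degree1_quadrature (m : nat) : (0 < m)%N ->
  has_chebyshev_quadrature (@sigma0 R) 1 (m + m).
Proof.
move=> m0; have mr : m%:R != 0 :> R by rewrite pnatr_eq0 -lt0n.
apply: (quadrature_symmetric (y := fun=> 0)) => // P sP.
have -> : \sum_(i < m) P^`().[0] = m%:R * P^`().[0] by rewrite sumr_const card_ord mulr_natl.
rewrite mulKf//.
rewrite !(horner_coef_wide _ sP) (horner_coef_wide _ (n := 2)).
  rewrite !big_ord_recl !big_ord0 /= !coef_deriv.
  have b0 : bump 0 0 = 1%N by [].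
  have b1 : bump 0 1 = 2%N by [].
  by rewrite b0 b1 mulr1n; field.
have [->|P0] := eqVneq P 0; first by rewrite deriv0 size_poly0.
by rewrite -ltnS (leq_trans (lt_size_deriv P0)).
Qed.

End even.

Theorem theorem1p10 (R : realType) :
  (exists C c : R, [/\ 0 < C, 0 < c,
     (forall n : nat, (0 < n)%N -> ~~ odd n ->
        ((c * Num.sqrt n%:R)%:E <= max_degree (@sigma0 R) n)%E)
   & (forall n : nat, odd n ->
        (max_degree (@sigma0 R) n <= (C * ln (C * n%:R))%:E)%E)]) /\
  (exists C1 c1 : R, [/\ 0 < C1, 0 < c1
   & forall k : nat, (0 < k)%N ->
        (min_nodes (@sigma0 R) k <= (C1 * k%:R ^+ 2)%:E)%E /\
        ((c1 * expR (c1 * k%:R))%:E <= min_nodes_onward (@sigma0 R) k)%E]).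
Proof.
split.
  (* The first constant is that of [odd_degree_ln]. For the second, [K] is the integer part of
     [sqrt m / 700] with [n = 2 m], so [sqrt n <= 3/2 * 700 (K + 1) <= 2100 K] once [K >= 1]. *)
  exists 256, (1 / (50 * 50)); split; [lra|lra| |].
    move=> n n0 en.
    have nE : n = (n./2 + n./2)%N by rewrite addnn even_halfK.
    set m := n./2 in nE.
    have m0 : (0 < m)%N by move: n0; rewrite nE addnn double_gt0.
    pose s : R := Num.sqrt m%:R.
    have s0 : 0 <= s by exact: sqrtr_ge0.
    have sE : s ^+ 2 = m%:R by rewrite sqr_sqrtr.
    have sn : Num.sqrt n%:R <= 3 / 2 * s.
      have s3 : 0 <= 3 / 2 * s by lra.
      rewrite -(ler_pXn2r (n := 2))// ?nnegrE ?sqrtr_ge0//.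
      rewrite sqr_sqrtr// exprMn sE nE natrD.
      by have : 0 <= m%:R :> R by []; lra.
    have bound K : has_chebyshev_quadrature (@sigma0 R) K n ->
        1 / (50 * 50) * Num.sqrt n%:R <= K%:R :> R ->
        ((1 / (50 * 50) * Num.sqrt n%:R)%:E <= max_degree (@sigma0 R) n)%E.
      move=> qK le; apply: (@le_trans _ _ (K%:R%:E : \bar R)); first by rewrite lee_fin.
      by apply: ereal_sup_ubound; exists K.
    have /andP[K1 K2] := truncn_itv (divr_ge0 s0 (ler0n R 700)).
    set K := Num.truncn _ in K1 K2.
    move: K2; rewrite -(natr1 K) ltr_pdivrMr ?ltr0n// => K2.
    have [Kz|K0] := posnP K.
      apply: (bound 1%N); first by rewrite nE; exact: degree1_quadrature.
      by move: K2; rewrite Kz mulr0n mulr1n; lra.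
    apply: (bound K).
      rewrite nE; apply: even_quadrature; first exact: K0.
      have h0 := ler0n R (700 * K).
      have h : (700 * K)%:R <= s by rewrite natrM mulrC -ler_pdivlMr ?ltr0n.
      by rewrite -(ler_nat R) -sE natrX !expr2; exact: ler_pM.
    have : 1 <= K%:R :> R by rewrite ler1n.
    lra.
  move=> n on; apply: ge_ereal_sup => _ [k [x qx] <-]; rewrite lee_fin.
  exact: (odd_degree_ln on qx).
exists (2 * (700 * 700)), (1 / 512); split; [lra|lra|] => k k0; split.
  apply: ereal_inf_lbound; exists ((700 * k) ^ 2 + (700 * k) ^ 2)%N.
    split; first by rewrite addn_gt0 expn_gt0 muln_gt0 k0.
    exact: even_quadrature.
  by congr (_%:E); rewrite natrD natrX natrM; ring.
apply: le_ereal_inf_tmp => _ [N [N0 HN] <-]; rewrite lee_fin.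
have N1 : 1 <= N%:R :> R by rewrite ler1n.
(* One of [N], [N + 1] is odd, so every admissible threshold is subject to the logarithmic bound. *)
have [n [on nN n2]] : exists n, [/\ odd n, (N <= n)%N & n%:R <= 2 * N%:R :> R].
  have [oN|eN] := boolP (odd N); first by exists N; split=> //; lra.
  by exists N.+1; split=> //; rewrite -natr1; lra.
have [x qx] := HN n nN.
have kn := odd_degree_ln on qx.
have kN : k%:R <= 256 * ln (512 * N%:R) :> R.
  have n1 : 1 <= n%:R :> R by rewrite ler1n; case: (n) on.
  have : ln (256 * n%:R) <= ln (512 * N%:R) :> R by rewrite ler_ln ?posrE; lra.
  lra.
have k_ge0 : 0 <= k%:R :> R by [].
(* The bound on [k] gives [k / 512 <= ln (512 N) / 2], and the logarithm is nonnegative. *)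
have : expR (1 / 512 * k%:R) <= 512 * N%:R :> R.
  have N5 : 0 < 512 * N%:R :> R by lra.
  rewrite -[leRHS]lnK ?posrE// ler_expR.
  have : 0 <= ln (512 * N%:R) :> R by lra.
  lra.
lra.
Qed.
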